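(* Let $n\ge 1$, let $f:\mathbb{R}^{n+1}\to\mathbb{R}$ be $C^4$, let $z\in\mathbb{R}^{n+1}$ with $\nabla f(z)\neq 0$, and let $M=\{x: f(x)=f(z)\}$ be the level hypersurface at $z$. Assume that $M$ is locally strictly convex at $z$, equivalently that the tangent-tangent Hessian of $f$ at $z$ is positive definite: $v^\top\nabla^2 f(z)v>0$ for all $v\neq 0$ with $\langle\nabla f(z),v\rangle=0$. Let $P(x)=\nabla f(z)\cdot(x-z)$, let $\Omega_z=\{x: f(x)\le f(z)\}$, and for $C<0$ (the values corresponding to the interior) let $g(C)$ be the centroid of the slice $S_C=\{x: P(x)=C\}\cap\Omega_z$. Then the inward one-sided limit $$d_{\mathrm{SC}}(z)\ \propto\ \lim_{C\uparrow 0}\frac{g(C)-z}{-C}$$ is well defined, and $d_{\mathrm{SC}}(z)$ is parallel to the affine normal direction $d_{\mathrm{AN}}(z)$.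
   Context: Affine normal direction: put $e_{n+1}=\nabla f(z)/\|\nabla f(z)\|$ and let $e_1,\dots,e_n$ be an orthonormal basis of $\nabla f(z)^\perp$. For $i,j,p,q\in\{1,\dots,n\}$ write $f_{ij}=D^2f(z)[e_i,e_j]$, $f_{n+1,i}=D^2f(z)[e_{n+1},e_i]$, $f_{pqi}=D^3f(z)[e_p,e_q,e_i]$, and let $(f^{ij})$ be the inverse matrix of $(f_{ij})_{1\le i,j\le n}$ (the tangent-tangent block of the Hessian). The affine normal direction is defined, up to scale, by $$d_{\mathrm{AN}}(z)\ \propto\ \sum_{i=1}^n\Big(\sum_{j=1}^n f^{ij}\Big(-\tfrac{1}{n+2}\|\nabla f(z)\|\sum_{p,q=1}^n f^{pq}f_{pqj}+f_{n+1,j}\Big)\Big)e_i-e_{n+1}.$$ The centroid $g(C)$ of $S_C$ is its barycenter with respect to $n$-dimensional Lebesgue measure on the hyperplane $\{P=C\}$ (considered when $S_C$ is a convex body). ''$\propto$'' means up to scale, and two nonzero vectors are parallel if one is a nonzero scalar multiple of the other. *)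

(* Defs.v *)
From HB Require Import structures.
From mathcomp Require Import all_boot all_order all_algebra.
From mathcomp Require Import all_classical all_reals all_analysis.

Set Implicit Arguments.
Unset Strict Implicit.
Unset Printing Implicit Defensive.
Import Order.TTheory GRing.Theory Num.Theory.
Import numFieldNormedType.Exports.
Local Open Scope classical_set_scope.
Local Open Scope ring_scope.

(* The library has the Borel sigma-algebra on [n.-tuple R] but no Lebesgue
   measure on it.  It is obtained by iterating the binary product measure
   along the bijection R * R^n -> R^(n+1);  [lebesgueRn_box] below
   characterizes it. *)

Definition tcons (R : realType) (n : nat)
    (p : measurableTypeR R * n.-tuple (measurableTypeR R)) :
    n.+1.-tuple (measurableTypeR R) := [tuple of p.1 :: p.2].

Lemma measurable_tcons (R : realType) (n : nat) :
  measurable_fun setT (@tcons R n).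
Proof. exact: measurable_cons. Qed.

Definition lebesgueRn_step (R : realType) (n : nat)
    (m : {sigma_finite_measure set n.-tuple (measurableTypeR R) -> \bar R}) :
    set (n.+1.-tuple (measurableTypeR R)) -> \bar R :=
  pushforward (lebesgue_measure \x m)%E (@tcons R n).

Section lebesgueRn_step_measure.
Context (R : realType) (n : nat).
Context (m : {sigma_finite_measure set n.-tuple (measurableTypeR R) -> \bar R}).

Let step0 : lebesgueRn_step m set0 = 0%E.
Proof. by rewrite /lebesgueRn_step /pushforward preimage_set0 measure0. Qed.

Let step_ge0 A : (0 <= lebesgueRn_step m A)%E.
Proof. exact: (measure_ge0 (lebesgue_measure \x m)%E). Qed.

Let step_sigma_additive : semi_sigma_additive (lebesgueRn_step m).
Proof.
move=> F mF tF mUF.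
have mp A : measurable A -> measurable (@tcons R n @^-1` A).
  by move=> mA; rewrite -[X in measurable X]setTI; exact: measurable_tcons.
rewrite /lebesgueRn_step /pushforward preimage_bigcup.
apply: (@measure_semi_sigma_additive _ _ _ (lebesgue_measure \x m)%E) => [i||].
- exact: mp.
- apply/trivIsetP => /= i j _ _ ij; rewrite -preimage_setI.
  by move/trivIsetP : tF => /(_ _ _ _ _ ij) ->//; rewrite preimage_set0.
- by rewrite -preimage_bigcup; exact: mp.
Qed.

HB.instance Definition _ := isMeasure.Build _ _ _ (lebesgueRn_step m)
  step0 step_ge0 step_sigma_additive.

Let step_sigma_finite : sigma_finite setT (lebesgueRn_step m).
Proof.
have /sigma_finiteP[F [TF ndF Foo]] := sigma_finiteT (@lebesgue_measure R).
have /sigma_finiteP[G [TG ndG Goo]] := sigma_finiteT m.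
pose g (t : n.+1.-tuple (measurableTypeR R)) := (thead t, [tuple of behead t]).
have Kg : g \o @tcons R n = id.
  by apply/funext => -[x t]; congr pair; apply: val_inj.
have mg : measurable_fun setT g.
  apply/measurable_fun_pair; last exact: measurable_behead.
  exact: measurable_tnth.
exists (fun k => g @^-1` (F k `*` G k)) => [|k].
  rewrite -preimage_bigcup -(preimage_setT g) -setXTT TF TG.
  congr (_ @^-1` _); apply/seteqP; split => -[x y] /=.
    move=> [[k _ Fx] [l _ Gy]]; exists (maxn k l) => //; split.
    - by move: x Fx; exact/subsetPset/ndF/leq_maxl.
    - by move: y Gy; exact/subsetPset/ndG/leq_maxr.
  by move=> [k _ []/= ? ?]; split; exists k.
have [mF Fk] := Foo k; have [mG Gk] := Goo k; split.
  by rewrite -[X in measurable X]setTI; apply: mg => //; exact: measurableX.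
rewrite /lebesgueRn_step /pushforward -comp_preimage Kg preimage_id.
by rewrite product_measure1E// lte_mul_pinfty// ge0_fin_numE.
Qed.

HB.instance Definition _ := Measure_isSigmaFinite.Build _ _ _
  (lebesgueRn_step m) step_sigma_finite.

End lebesgueRn_step_measure.

Fixpoint lebesgueRn (R : realType) (n : nat) :
    {sigma_finite_measure set n.-tuple (measurableTypeR R) -> \bar R} :=
  match n with
  | 0 => \d_[tuple]
  | k.+1 => lebesgueRn_step (lebesgueRn R k)
  end.

Lemma lebesgueRn_box (R : realType) (n : nat)
    (A : 'I_n -> set (measurableTypeR R)) :
  (forall i, measurable (A i)) ->
  lebesgueRn R n [set u | forall i, A i (tnth u i)] =
    (\prod_(i < n) lebesgue_measure (A i))%E.
Proof.
elim: n A => [|n IH] A mA.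
  rewrite big_ord0 /= diracE mem_set//.
  by case.
rewrite big_ord_recl -IH => [|i]; last exact: mA.
rewrite -product_measure1E; [|exact: mA|].
  rewrite /= /lebesgueRn_step /pushforward; congr (_ _).
  apply/seteqP; split => [[x t] /= h|[x t] /= [h0 hS] i].
    split=> [|i]; first exact: (h ord0).
    by have := h (lift ord0 i); rewrite tnthS.
  case: (unliftP ord0 i) => [j|] ->; last exact: h0.
  by rewrite tnthS; exact: hS.
rewrite [X in measurable X](_ : _ =
    \bigcap_i ((fun u => tnth u i) @^-1` A (lift ord0 i))).
  apply: fin_bigcap_measurable => // i _.
  by rewrite -[X in measurable X]setTI; apply: measurable_tnth => //; exact: mA.
by apply/seteqP; split => [u /= h i _|u /= h i]; exact: h.
Qed.

(* ['rV[R]_m] carries the sup norm of the library: this changes neither the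
   topology nor derivatives; lengths below are Euclidean ([enorm]). *)

Definition dot (R : realType) (m : nat) (u v : 'rV[R]_m) : R :=
  \sum_(i < m) u 0 i * v 0 i.

Definition enorm (R : realType) (m : nat) (u : 'rV[R]_m) : R :=
  Num.sqrt (dot u u).

(* [f] is C^(k+1) iff it is differentiable and [Df] is C^k; the latter is
   expressed through the evaluations [x |-> Df(x)v], as [v] ranges over the
   finite-dimensional space R^m. *)
Fixpoint Cn (R : realType) (m k : nat) (f : 'rV[R]_m -> R) : Prop :=
  match k with
  | 0 => continuous f
  | j.+1 => (forall x, differentiable f x) /\ forall v, Cn j (fun x => 'D_v f x)
  end.

Definition grad (R : realType) (m : nat) (f : 'rV[R]_m -> R) (x : 'rV[R]_m) :
  'rV[R]_m := \row_i 'D_(delta_mx 0 i) f x.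

Definition D2 (R : realType) (m : nat) (f : 'rV[R]_m -> R)
  (x u v : 'rV[R]_m) : R := 'D_u (fun y => 'D_v f y) x.

Definition D3 (R : realType) (m : nat) (f : 'rV[R]_m -> R)
  (x u v w : 'rV[R]_m) : R := 'D_u (fun y => D2 f y v w) x.

Definition Pfun (R : realType) (m : nat) (f : 'rV[R]_m -> R) (z x : 'rV[R]_m) :
  R := dot (grad f z) (x - z).

Definition hyperplane (R : realType) (m : nat) (f : 'rV[R]_m -> R)
  (z : 'rV[R]_m) (C : R) : set 'rV[R]_m := [set x | Pfun f z x = C].

Definition slice (R : realType) (m : nat) (f : 'rV[R]_m -> R) (z : 'rV[R]_m)
  (C : R) : set 'rV[R]_m := hyperplane f z C `&` [set x | f x <= f z].

(* Convex body of the affine subspace [H]: the interior is relative to [H]. *)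
Definition convex_body (R : realType) (m : nat) (H S : set 'rV[R]_m) : Prop :=
  [/\ S `<=` H, compact S, @convex_set R 'rV[R]_m S &
      exists2 x, S x & \forall y \near x, H y -> S y].

(* [e] is an orthonormal family orthogonal to [w]; with [n] vectors in R^(n+1)
   and [w != 0] this is an orthonormal basis of the orthogonal of [w]. *)
Definition tangent_frame (R : realType) (n : nat) (w : 'rV[R]_n.+1)
  (e : 'I_n -> 'rV[R]_n.+1) : Prop :=
  (forall i j, dot (e i) (e j) = (i == j)%:R) /\ (forall i, dot w (e i) = 0).

Definition flat_param (R : realType) (n : nat) (p : 'rV[R]_n.+1)
  (b : 'I_n -> 'rV[R]_n.+1) (u : n.-tuple (measurableTypeR R)) : 'rV[R]_n.+1 :=
  p + \sum_(i < n) (tnth u i : R) *: b i.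

(* Barycenter of [S] for n-dimensional Lebesgue measure on the affine subspace
   [p + span b], transported from R^n by the isometry [flat_param p b]
   ([b] orthonormal). *)
Definition centroid (R : realType) (n : nat) (p : 'rV[R]_n.+1)
  (b : 'I_n -> 'rV[R]_n.+1) (S : set 'rV[R]_n.+1) : 'rV[R]_n.+1 :=
  let U := flat_param p b @^-1` S in
  \row_k (Rintegral (lebesgueRn R n) U (fun u => flat_param p b u 0 k)
          / fine (lebesgueRn R n U)).

(* The base point is the orthogonal projection of [z] on [{P = C}]. *)
Definition slice_centroid (R : realType) (n : nat) (f : 'rV[R]_n.+1 -> R)
  (z : 'rV[R]_n.+1) (b : 'I_n -> 'rV[R]_n.+1) (C : R) : 'rV[R]_n.+1 :=
  centroid (z + (C / enorm (grad f z) ^+ 2) *: grad f z) b (slice f z C).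

Definition slice_quotient (R : realType) (n : nat) (f : 'rV[R]_n.+1 -> R)
  (z : 'rV[R]_n.+1) (b : 'I_n -> 'rV[R]_n.+1) (C : R) : 'rV[R]_n.+1 :=
  (- C)^-1 *: (slice_centroid f z b C - z).

Definition unit_normal (R : realType) (m : nat) (f : 'rV[R]_m -> R)
  (z : 'rV[R]_m) : 'rV[R]_m := (enorm (grad f z))^-1 *: grad f z.

Definition tangent_hessian (R : realType) (n : nat) (f : 'rV[R]_n.+1 -> R)
  (z : 'rV[R]_n.+1) (e : 'I_n -> 'rV[R]_n.+1) : 'M[R]_n :=
  \matrix_(i, j) D2 f z (e i) (e j).

Definition affine_normal (R : realType) (n : nat) (f : 'rV[R]_n.+1 -> R)
  (z : 'rV[R]_n.+1) (e : 'I_n -> 'rV[R]_n.+1) : 'rV[R]_n.+1 :=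
  let finv := invmx (tangent_hessian f z e) in
  let nu := unit_normal f z in
  \sum_(i < n)
    (\sum_(j < n) finv i j *
       (- (n.+2%:R^-1) * enorm (grad f z) *
          (\sum_(p < n) \sum_(q < n) finv p q * D3 f z (e p) (e q) (e j))
        + D2 f z nu (e j))) *: e i
  - nu.

Definition parallel (R : realType) (m : nat) (u v : 'rV[R]_m) : Prop :=
  [/\ u != 0, v != 0 & exists2 k : R, k != 0 & u = k *: v].

(* Main.v *)
Require Import Defs.
From mathcomp Require Import all_boot all_order all_algebra.
From mathcomp Require Import all_classical all_reals all_analysis.
From mathcomp Require Import measurable_realfun.
From mathcomp Require Import ring lra.
Import Order.TTheory GRing.Theory Num.Theory.
Import numFieldNormedType.Exports.
Local Open Scope classical_set_scope.
Local Open Scope ring_scope.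
Set Implicit Arguments.
Unset Strict Implicit.
Unset Printing Implicit Defensive.

(** Put [t = -C] and let [F u = f (z + C n0 + sum u_i b_i) - f z], with
[n0 = grad f z / |grad f z|^2], so that the slice is [U = {F <= 0}]; write [E]
for the average over [U].  If [G] vanishes wherever [F] does, then
[E (d_k G) = 0]: by Fubini this is the fundamental theorem of calculus on the
segments that the convex set [U] cuts on lines in the k-th direction.  Only
[G = F] and [G = u_j F] are needed, so no change of variables in the integrals.

Convexity confines [U] to [|u| <= K sqrt t], where Taylor's formula gives, up to
[o(t)], [F = - t + H(u,u)/2] and
[d_k F = - t D2f(n0,b_k) + H(u,b_k) + D3f(u,u,b_k)/2], [H] being the tangent
Hessian.  Let [M = E (u u^T) / t] and [m = E u / t].  The identities for [u_j F]
read [MH = (1 - tr(HM)/2) I + o(1)]; taking traces, [M -> 2/(n+2) H^-1].  The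
identity for [F] then yields the limit of [m H], hence that of [m], and the
limit of [(g(C) - z)/t] is [- n0 + sum m_i b_i]. *)

(** * Integration by parts over a sublevel set *)

(** The difficulty is one of orders. The slice has width of order [sqrt t], while the limit is
    governed by the mean of [u] to order [t], below the size of the points averaged. To leading
    order the slice is an ellipsoid symmetric about [u = 0], so this mean is produced entirely by
    the next order, where [D3 f] and the mixed term [D2 f n0 b_k] count. The identity for [F]
    reaches that order without describing the boundary so precisely: [d_k F] is linear in [u] to
    leading order, so the vanishing of its average fixes [H] applied to [E u] up to [o(t)], and in
    particular shows [E u = O(t)]; the cubic terms of [f] enter only through second moments.

    Taylor's formula is local whereas the slice is a global object; convexity turns an estimate on
    one small sphere into confinement of the whole slice.

    The measure lives on tuples and the calculus on row vectors; [mean_on] gathers the properties of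
    averages that the asymptotic argument uses. The centroid is computed in a frame [b] and the
    affine normal in another frame [e], hence the invariance argument at the end. *)

Lemma integral_sublevel_derive (R : realType) (F G g : R -> R) (M : R) :
  continuous F -> (forall x : R, is_derive x 1 G (g x)) -> continuous g ->
  (forall x y c, F x <= 0 -> F y <= 0 -> x <= c <= y -> F c <= 0) ->
  (forall x, F x <= 0 -> `|x| <= M) ->
  (forall x, F x = 0 -> G x = 0) ->
  (\int[@lebesgue_measure R]_(x in [set x | (F x <= 0)%R]) (g x)%:E = 0)%E.
Proof.
move=> cF dG cg Fconv Fbnd FG.
set S := [set x | _].
have [->|/set0P[x0 Sx0]] := eqVneq S set0; first by rewrite integral_set0.
have clS : closed S.
  exact: (iffLR (continuous_closedP F) cF _ (@closed_le R 0)).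
have ubS : has_ubound S by exists M => x /Fbnd; rewrite ler_norml => /andP[].
have lbS : has_lbound S by exists (- M) => x /Fbnd; rewrite ler_norml => /andP[].
have infS : has_inf S by split => //; exists x0.
have Sb : S (sup S).
  by rewrite [X in X _](iffLR (closure_id S) clS); apply: closure_sup => //; exists x0.
(* A point with [F < 0] is interior to [S], so it is neither the infimum nor the supremum: this
   forces [F], hence [G], to vanish at both ends. *)
have nearS c : F c < 0 -> exists2 e : R, 0 < e & S (c + e) /\ S (c - e).
  move=> Fc; have : \forall x \near c, F x < 0 by exact: cvgr_lt (F c) (cF c) _ Fc.
  move=> /nbhs_ballP[e /= e0 ecF].
  exists (e / 2); first by rewrite divr_gt0.
  by split; apply/ltW/ecF; rewrite -ball_normE /= ?opprD ?opprB ?addNKr ?addrA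
     ?subrr ?add0r ?normrN ger0_norm ?divr_ge0 1?ltW// ltr_pdivrMr// ltr_pMr// ltr1n.
have Sa : S (inf S).
  rewrite /S /= leNgt; apply/negP => Fa.
  have : \forall x \near inf S, 0 < F x.
    exact: cvgr_gt (F (inf S)) (cF (inf S)) _ Fa.
  move=> /nbhs_ballP[e /= e0 ecF].
  have [x Sx xe] := inf_adherent e0 infS.
  suff : 0 < F x by rewrite ltNge Sx.
  apply: ecF; rewrite -ball_normE /= ler0_norm; last by rewrite subr_le0 ge_inf.
  by rewrite opprB ltrBlDl.
set a := inf S in Sa *; set b := sup S in Sb *.
have SE : S = `[a, b]%classic.
  apply/seteqP; split => [x Sx|x]; rewrite /= in_itv/=.
    by apply/andP; split; [exact: ge_inf|exact: ub_le_sup].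
  by move=> axb; apply: Fconv axb.
have Fa0 : F a = 0.
  apply/eqP; rewrite eq_le [F a <= 0]Sa leNgt; apply/negP => /nearS[e e0 [_ Se]].
  by have := ge_inf lbS Se; rewrite -/a leNgt ltrBlDr ltrDl e0.
have Fb0 : F b = 0.
  apply/eqP; rewrite eq_le [F b <= 0]Sb leNgt; apply/negP => /nearS[e e0 [Se _]].
  by have := ub_le_sup ubS Se; rewrite -/b leNgt ltrDl e0.
have cG : continuous G.
  by move=> x; apply/differentiable_continuous/derivable1_diffP; case: (dG x).
have : a <= b by apply: ge_inf.
rewrite SE le_eqVlt => /predU1P[->|ab].
  by rewrite set_itv1 integral_set1.
rewrite (@continuous_FTC2 _ g G a b ab).
- by rewrite !FG// subee.
- by apply: continuous_subspaceT => x; apply: cg.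
- split.
  + by move=> x _; case: (dG x).
  + exact/cvg_at_right_filter/cG.
  + exact/cvg_at_left_filter/cG.
- by move=> x _; rewrite derive1E; case: (dG x).
Qed.

(** The bridge from the measurable space of tuples, where [lebesgueRn] lives, to the normed space of
    row vectors, where functions are differentiated. *)
Definition row_of_tuple (R : realType) n (u : n.-tuple (measurableTypeR R)) :
  'rV[R]_n := \row_i (tnth u i : R).

Lemma measurable_box (R : realType) n (A : 'I_n -> set (measurableTypeR R)) :
  (forall i, measurable (A i)) ->
  measurable [set u : n.-tuple (measurableTypeR R) | forall i, A i (tnth u i)].
Proof.
move=> mA.
rewrite [X in measurable X](_ : _ = \bigcap_i ((fun u => tnth u i) @^-1` A i)).
  apply: fin_bigcap_measurable => // i _.
  by rewrite -[X in measurable X]setTI; apply: measurable_tnth => //; exact: mA.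
by apply/seteqP; split => [u /= h i _|u /= h i]; exact: h.
Qed.

(** Balls of the sup norm are boxes, so an open set is the countable union of the boxes with
    rational centre and radius [1 / (k + 1)] that it contains. *)
Lemma measurable_row_open (R : realType) n (O : set 'rV[R]_n) :
  open O -> measurable (@row_of_tuple R n @^-1` O).
Proof.
move=> oO.
pose box (q : n.-tuple rat * nat) : set (n.-tuple (measurableTypeR R)) :=
  [set u | forall i, ball (ratr (tnth q.1 i) : R) (q.2.+1%:R^-1) (tnth u i)].
pose Q := [set q | box q `<=` @row_of_tuple R n @^-1` O].
rewrite [X in measurable X](_ : _ =
    \bigcup_q (if q \in Q then box q else set0)).
  apply: countable_bigcupT_measurable => // q; case: ifPn => // _.
  apply: (@measurable_box R n (fun i => ball (ratr (tnth q.1 i) : R) (q.2.+1%:R^-1))) => i.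
  apply: open_measurable; exact: ball_open.
apply/seteqP; split => [u Ou|u [q _]]; last first.
  by case: ifPn => // /set_mem; exact.
have /nbhs_ballP[e /= e0 eO] : nbhs (row_of_tuple u) O by exact: open_nbhs_nbhs.
(* Half of [e], because the distances from the rational centre to [u] and to another point of the
   box add up. *)
have [k ke] : exists k, k.+1%:R^-1 < e / 2.
  have e20 : 0 < e / 2 by rewrite divr_gt0.
  by have [k _ /(_ k (leqnn _))] := near_infty_natSinv_lt (PosNum e20); exists k.
have k0 : 0 < (k.+1%:R^-1 : R) by rewrite invr_gt0.
have qP i : {q : rat | ball (ratr q : R) (k.+1%:R^-1) (tnth u i)}.
  apply: cid.
  have [q /= uq] : exists q : rat,
      ratr q \in `](tnth u i : R) - k.+1%:R^-1, (tnth u i : R) + k.+1%:R^-1[.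
    by apply: rat_in_itvoo; rewrite ltrD2l gtrN.
  by exists q; move: uq; rewrite in_itv/= -ball_normE /= ltr_distl.
exists ([tuple sval (qP i) | i < n], k) => //.
rewrite mem_set; first by move=> i; rewrite /= tnth_mktuple; case: (qP i).
move=> w /= bw; apply: eO; split => // i j; rewrite !mxE.
have := bw j; rewrite tnth_mktuple; case: (qP j) => q /= uq /= wq.
rewrite [e]splitr; apply: (@ball_triangle _ _ (ratr q : R)).
  by apply/ball_sym; apply: le_ball uq; exact: ltW.
by apply: le_ball wq; exact: ltW.
Qed.

Lemma measurable_row_continuous (R : realType) n (phi : 'rV[R]_n -> R) :
  continuous phi ->
  measurable_fun [set: n.-tuple (measurableTypeR R)] (phi \o @row_of_tuple R n).
Proof.
move=> cphi; apply: (measurability _ (RGenOInfty.measurableE R)).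
move=> /= _ [_ [a ->]] <-; rewrite setTI comp_preimage.
apply: measurable_row_open.
apply: open_comp => //; exact: interval_open.
Qed.

Lemma lebesgueRn_cube_lty (R : realType) n (M : R) :
  (lebesgueRn R n [set u | forall i, (`|tnth u i : R| <= M)%R] < +oo)%E.
Proof.
rewrite (@lebesgueRn_box R n (fun=> [set x : R | `|x| <= M])); last first.
  move=> i; apply: closed_measurable.
  exact: (iffLR (continuous_closedP (@Num.norm R R)) (@norm_continuous _ _) _ (@closed_le R M)).
have -> : [set x : R | `|x| <= M] = `[- M, M]%classic.
  by apply/seteqP; split => x; rewrite /= in_itv /= ler_norml.
apply: (@proj2 (0 <= \prod_(i < n) lebesgue_measure `[(- M)%R, M]%classic)%E).
elim/big_rec: _ => [|i x _ [x0 xoo]]; first by rewrite lee01 ltry.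
split; first by rewrite mule_ge0.
rewrite lte_mul_pinfty// ge0_fin_numE// lebesgue_measure_itv/=.
by case: ifP => _; rewrite ?ltry.
Qed.

Lemma measurable_cube (R : realType) n (M : R) :
  measurable [set u : n.-tuple (measurableTypeR R) | forall i, `|tnth u i : R| <= M].
Proof.
apply: (@measurable_box R n (fun=> [set x : R | `|x| <= M])) => i.
apply: closed_measurable.
exact: (iffLR (continuous_closedP (@Num.norm R R)) (@norm_continuous _ _) _ (@closed_le R M)).
Qed.

Definition tuple_set (R : realType) n (k : 'I_n) (u : n.-tuple (measurableTypeR R))
    (x : measurableTypeR R) : n.-tuple (measurableTypeR R) :=
  [tuple if i == k then x else tnth u i | i < n].

Lemma tuple_set_cons0 (R : realType) n (u : n.-tuple (measurableTypeR R)) (y x : R) :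
  tuple_set ord0 (tcons (y, u)) x = tcons (x, u).
Proof.
apply: eq_from_tnth => i; rewrite tnth_mktuple.
by case: (unliftP ord0 i) => [j|] -> //=; rewrite !tnthS.
Qed.

Lemma tuple_set_consS (R : realType) n (u : n.-tuple (measurableTypeR R)) (k : 'I_n) (y x : R) :
  tuple_set (lift ord0 k) (tcons (y, u)) x = tcons (y, tuple_set k u x).
Proof.
apply: eq_from_tnth => i; rewrite tnth_mktuple.
case: (unliftP ord0 i) => [j|] -> //=; rewrite !tnthS tnth_mktuple.
by rewrite (inj_eq lift_inj).
Qed.

(** These conditions imply integrability, as Fubini requires, and they survive the freezing of one
    coordinate, so they can be carried through an induction on the dimension. *)
Definition bounded_cube_support (R : realType) n (B M : R)
    (Phi : n.-tuple (measurableTypeR R) -> R) :=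
  [/\ measurable_fun setT Phi, (forall u, `|Phi u| <= B) &
      forall u, Phi u != 0 -> forall i, `|tnth u i : R| <= M].

Lemma integrable_bounded_support d (T : measurableType d) (R : realType)
    (mu : {measure set T -> \bar R}) (f : T -> R) (A : set T) (B : R) :
  measurable A -> (mu A < +oo)%E -> measurable_fun setT f ->
  (forall x, `|f x| <= B) -> (forall x, f x != 0 -> A x) ->
  mu.-integrable setT (EFin \o f).
Proof.
move=> mA Aoo mf fB fA.
have -> : EFin \o f = (EFin \o f) \_ A.
  apply/funext => x; rewrite patchE /=; case: ifPn => // xA.
  by have [->//|/fA/mem_set] := eqVneq (f x) 0; rewrite (negbTE xA).
apply/(integrable_mkcond _ mA).
apply: measurable_bounded_integrable => //; first exact: measurable_funS mf.
by exists B; split; [exact: num_real|move=> y By x _; exact: le_trans (fB x) (ltW By)].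
Qed.

(** The first coordinate is split off. If [k] is a later coordinate, the inner integral over the
    remaining ones vanishes by induction; if [k] is the first, the order of integration is exchanged
    and the inner integral vanishes by hypothesis. *)
Lemma integral_lebesgueRn_eq0 (R : realType) (n : nat) (B M : R) (k : 'I_n)
    (Phi : n.-tuple (measurableTypeR R) -> R) :
  bounded_cube_support B M Phi ->
  (forall u, (\int[@lebesgue_measure R]_x (Phi (tuple_set k u x))%:E = 0)%E) ->
  (\int[lebesgueRn R n]_u (Phi u)%:E = 0)%E.
Proof.
elim: n k Phi => [[]//|n IH] k Phi [mPhi PhiB PhiM] Phi0.
pose A := [set u : n.+1.-tuple (measurableTypeR R) | forall i, `|tnth u i : R| <= M].
have mA : measurable A by exact: measurable_cube.
have mtA : measurable (@tcons R n @^-1` A).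
  by rewrite -[X in measurable X]setTI; exact: measurable_tcons.
have mPt : measurable_fun setT (Phi \o @tcons R n).
  by apply: measurableT_comp mPhi _; exact: measurable_tcons.
have iPt : (lebesgue_measure \x lebesgueRn R n)%E.-integrable setT
    (EFin \o (Phi \o @tcons R n)).
  apply: (@integrable_bounded_support _ _ _ _ _ (@tcons R n @^-1` A) B) => //.
  - exact: (lebesgueRn_cube_lty n.+1 M).
  - by move=> x; exact: PhiB.
  - by move=> x; exact: PhiM.
have -> : (\int[lebesgueRn R n.+1]_u (Phi u)%:E =
    \int[(lebesgue_measure \x lebesgueRn R n)%E]_p (Phi (tcons p))%:E)%E.
  rewrite (@integral_pushforward _ _ _ _ _ (@tcons R n) (@measurable_tcons R n)
    _ setT (EFin \o Phi)) //.
    exact/measurable_EFinP.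
case: (unliftP ord0 k) => [j|] kE; rewrite kE in Phi0.
  rewrite -integral12_prod_meas1//.
  apply: integral0_eq => y _; apply: (IH j (fun u => Phi (tcons (y, u)))).
    split=> [|u|u Pu i].
    - apply: measurableT_comp mPhi _; apply: measurableT_comp (@measurable_tcons R n) _.
      exact: measurable_pair1.
    - exact: PhiB.
    - by have := PhiM _ Pu (lift ord0 i); rewrite tnthS.
  by move=> u; have := Phi0 (tcons (y, u)); under eq_integral do rewrite tuple_set_consS.
rewrite -integral21_prod_meas1//.
(* The entry 0 is a placeholder that [tuple_set ord0] overwrites. *)
apply: integral0_eq => u _; have := Phi0 (tcons (0, u)).
by under eq_integral do rewrite tuple_set_cons0.
Qed.

Lemma is_derive_line (R : realType) (V : normedModType R) (f : V -> R) (a v : V) (x df : R) :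
  is_derive (a + x *: v) v f df -> is_derive x 1 (fun y : R => f (a + y *: v)) df.
Proof.
move=> [dfx dfE].
have eqf : (fun h : R => h^-1 *: (((fun y : R => f (a + y *: v)) \o shift x) (h *: 1) -
    f (a + x *: v))) = (fun h => h^-1 *: ((f \o shift (a + x *: v)) (h *: v) - f (a + x *: v))).
  apply/funext => h /=; congr (_ *: (f _ - _)).
  by rewrite [h *: 1]mulr1 scalerDl addrCA.
by split; [rewrite /derivable eqf|rewrite -dfE /derive eqf].
Qed.

Lemma row_of_tuple_set (R : realType) n (k : 'I_n) (u : n.-tuple (measurableTypeR R)) (x : R) :
  row_of_tuple (tuple_set k u x) =
  (row_of_tuple u - (tnth u k : R) *: delta_mx 0 k) + x *: delta_mx 0 k.
Proof.
apply/rowP => i; rewrite !mxE tnth_mktuple eqxx/=.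
by case: eqP => [->|_]; rewrite ?mulr1 ?mulr0 ?subrr ?add0r // subr0 addr0.
Qed.

Lemma continuous_line (R : realType) (V : normedModType R) (a v : V) :
  continuous (fun y : R => a + y *: v).
Proof.
by move=> x; apply: cvgD; [exact: cvg_cst|apply: cvgZr_tmp; exact: cvg_id].
Qed.

Lemma row_norm_le (R : realType) n (v : 'rV[R]_n) (c : R) :
  0 <= c -> (forall i, `|v 0 i| <= c) -> `|v| <= c.
Proof.
move=> c0 vc; rewrite /Num.norm /= mx_normrE; apply/bigmax_leP; split => // -[i j] _ /=.
by rewrite ord1.
Qed.

Lemma row_coord_le (R : realType) n (v : 'rV[R]_n) i : `|v 0 i| <= `|v|.
Proof.
rewrite [leRHS]/Num.norm /= mx_normrE; apply/bigmax_geP; right.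
by exists (0, i).
Qed.

Definition sublevel_convex (R : realType) (V : lmodType R) (F : V -> R) :=
  forall v w (t : R), F v <= 0 -> F w <= 0 -> 0 <= t <= 1 -> F (v + t *: (w - v)) <= 0.

Definition tsublevel (R : realType) n (F : 'rV[R]_n -> R) : set (n.-tuple (measurableTypeR R)) :=
  [set u | F (row_of_tuple u) <= 0].

Section body.
Context (R : realType) (n : nat) (F : 'rV[R]_n -> R) (M : R).
Hypothesis cF : continuous F.
Hypothesis Fconv : sublevel_convex F.
Hypothesis FM : forall v, F v <= 0 -> forall i, `|v 0 i| <= M.

Local Notation U := (tsublevel F).
Implicit Types g : 'rV[R]_n -> R.

Lemma measurable_tsublevel : measurable U.
Proof.
rewrite -[X in measurable X]setCK; apply: measurableC.
have -> : ~` U = @row_of_tuple R n @^-1` (F @^-1` [set y | 0 < y]).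
  by apply/seteqP; split => u /=; rewrite /tsublevel /= ltNge => /negP.
apply: measurable_row_open; apply: open_comp => //; exact: open_gt.
Qed.

Lemma tsublevel_lty : (lebesgueRn R n U < +oo)%E.
Proof.
apply: le_lt_trans (lebesgueRn_cube_lty n M).
apply: le_measure; rewrite ?inE; [exact: measurable_tsublevel|exact: measurable_cube|].
by move=> u /= /FM h i; have := h i; rewrite mxE.
Qed.

Lemma tsublevel_bounded g : continuous g -> exists B, forall v, F v <= 0 -> `|g v| <= B.
Proof.
move=> cg.
have cpt : compact [set v | F v <= 0].
  apply: bounded_closed_compact; last first.
    exact: (iffLR (continuous_closedP F) cF _ (@closed_le R 0)).
  exists `|M|; split => [|x Mx v Fv]; first exact: num_real.
  apply: row_norm_le => [|j]; first exact: le_trans (ltW Mx).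
  by rewrite (le_trans (FM Fv j))// (le_trans (ler_norm _))// ltW.
have : bounded_set (g @` [set v | F v <= 0]).
  apply: compact_bounded; apply: continuous_compact => //.
  exact: continuous_subspaceT.
case=> B [_ /(_ (B + 1))]; rewrite ltrDl ltr01 => /(_ isT) gB.
by exists (B + 1) => v Fv; apply: gB; exists v.
Qed.

Lemma tsublevel_integrable g : continuous g ->
  (lebesgueRn R n).-integrable U (EFin \o (g \o @row_of_tuple R n)).
Proof.
move=> cg; have [B gB] := tsublevel_bounded cg.
apply: measurable_bounded_integrable.
- exact: measurable_tsublevel.
- exact: tsublevel_lty.
- by apply: (@measurable_funS _ _ _ _ setT) => //; exact: measurable_row_continuous.
- exists B; split; [exact: num_real|move=> y By x Ux].
  by apply: le_trans (ltW By); exact: gB.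
Qed.

(** Extended by zero off the sublevel set, [g] may jump but stays bounded, measurable and supported
    in a cube, which suffices for the reduction to lines parallel to the k-th axis. *)
Lemma integral_tsublevel_derive (k : 'I_n) (G g : 'rV[R]_n -> R) :
  (forall v, is_derive v (delta_mx 0 k) G (g v)) -> continuous g ->
  (forall v, F v = 0 -> G v = 0) ->
  (\int[lebesgueRn R n]_(u in U) (g (row_of_tuple u))%:E = 0)%E.
Proof.
move=> dG cg FG; have [B gB] := tsublevel_bounded cg.
rewrite integral_mkcond/=.
pose Phi := (g \o @row_of_tuple R n) \_ U.
have PhiE : (fun u => (g (row_of_tuple u))%:E) \_ U = EFin \o Phi.
  by apply/funext => u; rewrite /Phi /= !patchE; case: ifP.
(* [B] bounds [g] on the sublevel set only and may be negative when that set is empty; elsewhere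
   [Phi] is 0. *)
rewrite PhiE; apply: (@integral_lebesgueRn_eq0 R n (Num.max B 0) M k Phi).
  split.
  - apply/(measurable_restrictT _ measurable_tsublevel).
    by apply: (@measurable_funS _ _ _ _ setT) => //; exact: measurable_row_continuous.
  - move=> u; rewrite /Phi patchE; case: ifPn => [/set_mem/= Uu|_].
      by rewrite le_max gB.
    by rewrite normr0 le_max lexx orbT.
  - move=> u; rewrite /Phi patchE; case: ifPn => [/set_mem/= Uu _ i|_]; last by rewrite eqxx.
    by have := FM Uu i; rewrite mxE.
move=> u.
pose a := row_of_tuple u - (tnth u k : R) *: delta_mx 0 k.
pose e := delta_mx 0 k : 'rV[R]_n.
transitivity (\int[@lebesgue_measure R]_(x in [set x | (F (a + x *: e) <= 0)%R])
    (g (a + x *: e))%:E)%E.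
  rewrite [RHS]integral_mkcond/=; apply: eq_integral => x _.
  rewrite /Phi !patchE /=.
  have -> : (tuple_set k u x \in U) = (x \in [set x | (F (a + x *: e) <= 0)%R]).
    by apply/idP/idP; rewrite !inE /= /tsublevel /= row_of_tuple_set.
  by rewrite row_of_tuple_set; case: ifP.
have cl := @continuous_line R _ a e.
(* The k-th coordinate of [a + x *: e] is [a 0 k + x], so the bound [M] on it bounds [x] by the
   triangle inequality. *)
apply: (@integral_sublevel_derive R (fun x => F (a + x *: e)) (fun x => G (a + x *: e))
   (fun x => g (a + x *: e)) (M + `|a 0 k|)).
- by move=> x; apply: continuous_comp; [exact: cl|exact: cF].
- by move=> x; apply: is_derive_line.
- by move=> x; apply: continuous_comp; [exact: cl|exact: cg].
- move=> x y c Fx Fy /andP[xc cy].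
  have [xy|xy] := eqVneq x y.
    by have <- : x = c; [apply/le_anti; rewrite xc xy cy|].
  have xy0 : 0 < y - x by rewrite subr_gt0 lt_neqAle xy (le_trans xc).
  have t01 : 0 <= (c - x) / (y - x) <= 1.
    apply/andP; split; first by rewrite divr_ge0 ?subr_ge0 // (le_trans xc).
    by rewrite ler_pdivrMr// mul1r lerB.
  have := Fconv Fx Fy t01.
  suff -> : a + x *: e + (c - x) / (y - x) *: (a + y *: e - (a + x *: e)) = a + c *: e by [].
  rewrite opprD addrACA subrr add0r -scalerBl scalerA divfK ?gt_eqF//.
  by rewrite -addrA -scalerDl addrCA subrr addr0.
- move=> x Fx.
  have ek : e 0 k = 1 by rewrite /e mxE !eqxx.
  have aM : `|a 0 k + x| <= M by have := FM Fx k; rewrite mxE [(x *: e) 0 k]mxE ek mulr1.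
  have := ler_normB (a 0 k + x) (a 0 k); rewrite addrAC subrr add0r => /le_trans.
  by apply; rewrite lerD2r.
- by move=> x; exact: FG.
Qed.

End body.

(** * Averages *)

Lemma continuous_sum (R : realType) (T : topologicalType) (V : normedModType R)
    (I : Type) (r : seq I) (g : I -> T -> V) :
  (forall i, continuous (g i)) -> continuous (fun v => \sum_(i <- r) g i v).
Proof.
move=> cg; elim: r => [|i r IH] x.
  have -> : (fun v => \sum_(j <- [::]) g j v) = (fun=> 0).
    by apply/funext => v; rewrite big_nil.
  exact: cvg_cst.
have -> : (fun v => \sum_(j <- i :: r) g j v) = (fun v => g i v + \sum_(j <- r) g j v).
  by apply/funext => v; rewrite big_cons.
exact: (cvgD (cg i x) (IH x)).
Qed.

Lemma continuous_coord2 (R : realType) n (i j : 'I_n) :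
  continuous (fun v : 'rV[R]_n => v 0 i * v 0 j).
Proof.
move=> v; exact: (cvgM (@coord_continuous R 1 n 0 i v) (@coord_continuous R 1 n 0 j v)).
Qed.

Definition qform (R : realType) n (H : 'I_n -> 'I_n -> R) (v : 'rV[R]_n) : R :=
  \sum_i \sum_j v 0 i * v 0 j * H i j.

Lemma continuous_qform (R : realType) n (H : 'I_n -> 'I_n -> R) : continuous (qform H).
Proof.
apply: continuous_sum => i; apply: continuous_sum => j v.
exact: (cvgM (@continuous_coord2 R n i j v) (cvg_cst (H i j))).
Qed.

Section row_continuity.
Context (R : realType) (n : nat).

Lemma continuous_scale_fun (c : R) (g : 'rV[R]_n -> R) :
  continuous g -> continuous (fun v => c * g v).
Proof. by move=> cg v; exact: (cvgM (cvg_cst c) (cg v)). Qed.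

Lemma continuous_add_fun (g h : 'rV[R]_n -> R) :
  continuous g -> continuous h -> continuous (fun v => g v + h v).
Proof. by move=> cg ch v; exact: (cvgD (cg v) (ch v)). Qed.

Lemma continuous_sub_fun (g h : 'rV[R]_n -> R) :
  continuous g -> continuous h -> continuous (fun v => g v - h v).
Proof. by move=> cg ch v; exact: (cvgB (cg v) (ch v)). Qed.

Lemma continuous_mul_fun (g h : 'rV[R]_n -> R) :
  continuous g -> continuous h -> continuous (fun v => g v * h v).
Proof. by move=> cg ch v; exact: (cvgM (cg v) (ch v)). Qed.

Lemma continuous_cst_fun (c : R) : continuous ((fun=> c) : 'rV[R]_n -> R).
Proof. exact: cst_continuous. Qed.

Lemma continuous_coord_fun i : continuous (fun v : 'rV[R]_n => v 0 i).
Proof. exact: (@coord_continuous R 1 n 0 i). Qed.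

Lemma continuous_linear_row (a : 'I_n -> R) :
  continuous (fun v : 'rV[R]_n => \sum_i v 0 i * a i).
Proof.
apply: continuous_sum => i v.
exact: (cvgM (@coord_continuous R 1 n 0 i v) (cvg_cst (a i))).
Qed.

End row_continuity.

(** An interface to averages over the set where [F <= 0]: the asymptotic analysis uses these five
    properties in place of integrals. The last one is integration by parts. *)
Record mean_on (R : realType) n (F : 'rV[R]_n -> R)
    (E : ('rV[R]_n -> R) -> R) : Prop := {
  mean_cst : forall c, E (fun=> c) = c;
  meanD : forall g h : 'rV[R]_n -> R, continuous g -> continuous h ->
    E (fun v => g v + h v) = E g + E h;
  meanZ : forall (c : R) (g : 'rV[R]_n -> R), continuous g ->
    E (fun v => c * g v) = c * E g;
  mean_le : forall (g : 'rV[R]_n -> R) (B : R), continuous g ->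
    (forall v, F v <= 0 -> `|g v| <= B) -> `|E g| <= B;
  mean_derive : forall (k : 'I_n) (G g : 'rV[R]_n -> R),
    (forall v, is_derive v (delta_mx 0 k) G (g v)) -> continuous g ->
    (forall v, F v = 0 -> G v = 0) -> E g = 0 }.

Definition sublevel_mean (R : realType) n (F g : 'rV[R]_n -> R) : R :=
  Rintegral (lebesgueRn R n) (tsublevel F) (g \o @row_of_tuple R n) /
  fine (lebesgueRn R n (tsublevel F)).

(** By continuity the set contains a sup-norm ball around [v0], which is a box with sides of
    positive length. *)
Lemma tsublevel_gt0 (R : realType) n (F : 'rV[R]_n -> R) (v0 : 'rV[R]_n) :
  continuous F -> F v0 < 0 -> (0 < lebesgueRn R n (tsublevel F))%E.
Proof.
move=> cF Fv0.
have : \forall v \near v0, F v < 0 by exact: cvgr_lt (F v0) (cF v0) _ Fv0.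
move=> /nbhs_ballP[e /= e0 eF].
pose A (i : 'I_n) : set (measurableTypeR R) := ball (v0 0 i) e.
have mA i : measurable (A i) by apply: open_measurable; exact: ball_open.
have : (lebesgueRn R n [set u | forall i, A i (tnth u i)] <= lebesgueRn R n (tsublevel F))%E.
  apply: le_measure; rewrite ?inE; [exact: measurable_box|exact: measurable_tsublevel|].
  move=> u /= Au; apply/ltW/eF; split => // i j; rewrite ord1 mxE; exact: Au.
apply: lt_le_trans; rewrite lebesgueRn_box//.
elim/big_ind: _ => [|x y x0 y0|i _]; [exact: lte01|exact: mule_gt0|].
by rewrite lebesgue_measure_ball ?(ltW e0)// lte_fin mulrn_wgt0.
Qed.

Lemma sublevel_mean_on (R : realType) n (F : 'rV[R]_n -> R) (M : R) (v0 : 'rV[R]_n) :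
  continuous F -> sublevel_convex F -> (forall v, F v <= 0 -> forall i, `|v 0 i| <= M) ->
  F v0 < 0 -> mean_on F (sublevel_mean F).
Proof.
move=> cF Fconv FM Fv0.
have mU := measurable_tsublevel cF.
have U0 : 0 < fine (lebesgueRn R n (tsublevel F)).
  by apply: fine_gt0; rewrite (tsublevel_gt0 cF Fv0) (tsublevel_lty cF FM).
have iU (g : 'rV[R]_n -> R) : continuous g ->
    (lebesgueRn R n).-integrable (tsublevel F) (EFin \o (g \o @row_of_tuple R n)).
  exact: (tsublevel_integrable cF FM).
have ccst (c : R) : continuous ((fun=> c) : 'rV[R]_n -> R) by exact: cst_continuous.
split.
- by move=> c; rewrite /sublevel_mean Rintegral_cst// mulfK// gt_eqF.
- by move=> g h cg ch; rewrite /sublevel_mean -mulrDl -RintegralD// ?iU.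
- by move=> c g cg; rewrite /sublevel_mean mulrA -RintegralZl// iU.
- move=> g B cg gB; rewrite /sublevel_mean normrM [X in _ * X]gtr0_norm ?invr_gt0//.
  rewrite ler_pdivrMr// -(Rintegral_cst _ mU).
  apply: le_trans (le_normr_Rintegral mU (iU _ cg)) _.
  apply: le_Rintegral => //.
  + by apply: (iU (fun v => `|g v|)) => x; apply: (continuous_comp (cg x)); exact: norm_continuous.
  + exact: (iU (fun=> B)).
  + by move=> u; exact: gB.
- move=> k G g dG cg FG; rewrite /sublevel_mean /Rintegral.
  by rewrite (integral_tsublevel_derive cF Fconv FM dG cg FG) mul0r.
Qed.

Section mean.
Context (R : realType) (n : nat) (F : 'rV[R]_n -> R) (E : ('rV[R]_n -> R) -> R).
Hypothesis mE : mean_on F E.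

Lemma mean_sum (I : finType) (g : I -> 'rV[R]_n -> R) :
  (forall i, continuous (g i)) -> E (fun v => \sum_i g i v) = \sum_i E (g i).
Proof.
move=> cg; elim: (index_enum I) => [|i s IH].
  rewrite big_nil -[RHS](mean_cst mE); congr E; apply/funext => v; exact: big_nil.
rewrite big_cons -IH -(meanD mE (cg i) (continuous_sum cg)).
by congr E; apply/funext => v; rewrite big_cons.
Qed.

Lemma meanB (g h : 'rV[R]_n -> R) :
  continuous g -> continuous h -> E (fun v => g v - h v) = E g - E h.
Proof.
move=> cg ch; have cNh := continuous_scale_fun (c := -1) ch.
rewrite -mulN1r -(meanZ mE _ ch) -(meanD mE cg cNh).
by congr E; apply/funext => v; rewrite mulN1r.
Qed.

Lemma mean_qform (A : 'I_n -> 'I_n -> R) :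
  E (qform A) = \sum_i \sum_j A i j * E (fun v => v 0 i * v 0 j).
Proof.
have c2 i j : continuous (fun v : 'rV[R]_n => v 0 i * v 0 j * A i j).
  by move=> v; exact: (cvgM (@continuous_coord2 R n i j v) (cvg_cst (A i j))).
rewrite (mean_sum (g := fun i (v : 'rV[R]_n) => \sum_j v 0 i * v 0 j * A i j)); last first.
  by move=> i; apply: continuous_sum.
apply: eq_bigr => i _; rewrite (mean_sum (g := fun j (v : 'rV[R]_n) => v 0 i * v 0 j * A i j))//.
apply: eq_bigr => j _; rewrite -(meanZ mE); last exact: continuous_coord2.
by congr E; apply/funext => v; rewrite mulrC.
Qed.

Lemma mean_linear (a : 'I_n -> R) :
  E (fun v => \sum_i v 0 i * a i) = \sum_i a i * E (fun v => v 0 i).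
Proof.
have c1 i : continuous (fun v : 'rV[R]_n => v 0 i) by exact: (@coord_continuous R 1 n 0 i).
rewrite (mean_sum (g := fun i (v : 'rV[R]_n) => v 0 i * a i)); last first.
  by move=> i v; exact: (cvgM (c1 i v) (cvg_cst (a i))).
apply: eq_bigr => i _; rewrite -(meanZ mE)//.
by congr E; apply/funext => v; rewrite mulrC.
Qed.

End mean.

(** * Second-order expansions *)

Lemma is_derive_sub_quadratic (R : realType) (g : R -> R) (t dg A B : R) :
  is_derive t 1 g dg ->
  is_derive t 1 (fun s => g s - s * A - 2^-1 * s ^+ 2 * B) (dg - A - t * B).
Proof.
move=> dgt; pose p : {poly R} := A *: 'X + (2^-1 * B) *: 'X^2.
have -> : (fun s => g s - s * A - 2^-1 * s ^+ 2 * B) = g - horner p.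
  apply/funext => s; rewrite -[RHS]/(g s - p.[s]) /p.
  by rewrite hornerD hornerZ hornerX hornerZ hornerXn; ring.
apply: is_derive_eq.
rewrite /p derivD !derivZ derivX derivXn hornerD !hornerZ hornerC hornerMn hornerXn.
by field.
Qed.

Section derivatives.
Context (R : realType) (m : nat).
Implicit Types (phi : 'rV[R]_m -> R) (x u v w : 'rV[R]_m).

Lemma derive_combination phi x (I : finType) (a : I -> R) (w : I -> 'rV[R]_m) :
  differentiable phi x ->
  'D_(\sum_i a i *: w i) phi x = \sum_i a i * 'D_(w i) phi x.
Proof.
move=> dphi; rewrite deriveE// linear_sum; apply: eq_bigr => i _.
by rewrite linearZ/= deriveE.
Qed.

Lemma deriveDdir phi x u v : differentiable phi x ->
  'D_(u + v) phi x = 'D_u phi x + 'D_v phi x.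
Proof. by move=> dphi; rewrite !deriveE// linearD. Qed.

Lemma deriveZdir phi x (c : R) v : differentiable phi x ->
  'D_(c *: v) phi x = c * 'D_v phi x.
Proof. by move=> dphi; rewrite !deriveE// linearZ. Qed.

Lemma derive_sum_fun x u (I : finType) (a : I -> R) (g : I -> 'rV[R]_m -> R) :
  (forall i, differentiable (g i) x) ->
  is_derive x u (fun y => \sum_i a i * g i y) (\sum_i a i * 'D_u (g i) x).
Proof.
move=> dg; elim: (index_enum I) => [|i s IH].
  under eq_fun do rewrite big_nil; rewrite big_nil; exact: is_derive_cst.
under eq_fun do rewrite big_cons; rewrite big_cons.
apply: is_deriveD.
have gi : is_derive x u (g i) ('D_u (g i) x) by apply/derivableP/diff_derivable.
exact: (is_deriveZ (a i) gi).
Qed.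

(** Mirrors [Cn]: second-order differentiability is read off the directional derivatives. First
    derivatives are required at every point because linearity of ['D_v phi] in [v] is used as an
    equality of functions before differentiating again. *)
Definition twice_differentiable phi x :=
  (forall y, differentiable phi y) /\ (forall v, differentiable (fun y => 'D_v phi y) x).

Lemma D2_combinationl phi x (I : finType) (a : I -> R) (w : I -> 'rV[R]_m) v :
  twice_differentiable phi x ->
  D2 phi x (\sum_i a i *: w i) v = \sum_i a i * D2 phi x (w i) v.
Proof. by move=> [_ d2]; exact: derive_combination. Qed.

Lemma D2_combinationr phi x (I : finType) (a : I -> R) (w : I -> 'rV[R]_m) u :
  twice_differentiable phi x ->
  D2 phi x u (\sum_i a i *: w i) = \sum_i a i * D2 phi x u (w i).
Proof.
move=> [d1 d2]; rewrite /D2.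
have -> : (fun y => 'D_(\sum_i a i *: w i) phi y) = (fun y => \sum_i a i * 'D_(w i) phi y).
  by apply/funext => y; exact: derive_combination.
by have [] := @derive_sum_fun x u I a (fun i y => 'D_(w i) phi y) (fun i => d2 (w i)).
Qed.

Lemma D2Dl phi x u v w : twice_differentiable phi x ->
  D2 phi x (u + v) w = D2 phi x u w + D2 phi x v w.
Proof. by move=> [_ d2]; exact: deriveDdir. Qed.

Lemma D2Zl phi x (c : R) v w : twice_differentiable phi x ->
  D2 phi x (c *: v) w = c * D2 phi x v w.
Proof. by move=> [_ d2]; exact: deriveZdir. Qed.

Lemma D2Zr phi x (c : R) v w : twice_differentiable phi x ->
  D2 phi x v (c *: w) = c * D2 phi x v w.
Proof.
move=> d2; have := @D2_combinationr phi x 'I_1 (fun=> c) (fun=> w) v d2.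
by rewrite !big_ord1.
Qed.

Lemma D2Dr phi x u v w : twice_differentiable phi x ->
  D2 phi x u (v + w) = D2 phi x u v + D2 phi x u w.
Proof.
move=> [d1 d2]; rewrite /D2.
have -> : (fun y => 'D_(v + w) phi y) = (fun y => 'D_v phi y) + (fun y => 'D_w phi y).
  by apply/funext => y; exact: deriveDdir.
by rewrite deriveD//; exact: diff_derivable.
Qed.

Lemma row_basis (v : 'rV[R]_m) : v = \sum_i v 0 i *: delta_mx 0 i.
Proof. exact: row_sum_delta. Qed.

Lemma differentiable_peano phi x (e : R) : differentiable phi x -> 0 < e ->
  \forall h \near (0 : 'rV[R]_m), `|phi (x + h) - phi x - 'D_h phi x| <= e * `|h|.
Proof.
move=> dphi e0; have := diff_locally dphi; set o := the_littleo _ _ _ _ _ => E.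
have := @littleoP _ _ _ _ _ _ o e e0; apply: filterS => h.
have := congr1 (@^~ h) E; rewrite /= [h + x]addrC !fctE => ->.
by rewrite deriveE// (_ : _ - _ - _ = o h)//; ring.
Qed.

Lemma row_expand_le (v : 'rV[R]_m) (g : 'I_m -> R) (c : R) :
  (forall i, `|g i| <= c) -> `|\sum_i v 0 i * g i| <= m%:R * c * `|v|.
Proof.
move=> gc; apply: le_trans (ler_norm_sum _ _ _) _.
apply: (@le_trans _ _ (\sum_(i < m) c * `|v|)).
  apply: ler_sum => i _; rewrite normrM mulrC.
  by apply: ler_pM => //; exact: row_coord_le.
by rewrite sumr_const card_ord -[leLHS]mulr_natl mulrA.
Qed.

(* Only [D phi] needs a first-order expansion at [x]: the mean value theorem along
   the segment transfers it to a second-order expansion of [phi]. *)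
Lemma taylor2_peano phi x (e : R) : twice_differentiable phi x -> 0 < e ->
  exists2 d : R, 0 < d & forall h, `|h| < d ->
    `|phi (x + h) - phi x - 'D_h phi x - 2^-1 * D2 phi x h h| <= e * `|h| ^+ 2.
Proof.
move=> d12 e0; have [d1 d2] := d12.
(* Each of the [m] coordinates of [h] contributes an error of at most [e' * |h| ^ 2]; the added 1
   keeps the denominator positive when [m = 0]. *)
pose e' := e / (m%:R + 1).
have m0 : 0 < m%:R + 1 :> R by rewrite ltr_wpDl.
have e'0 : 0 < e' by rewrite divr_gt0.
pose psi i y := 'D_(delta_mx 0 i) phi y.
have psiP i : \forall h \near (0 : 'rV[R]_m),
    `|psi i (x + h) - psi i x - 'D_h (psi i) x| <= e' * `|h|.
  exact: (differentiable_peano (d2 _) e'0).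
have := @filter_forall _ _ _ _ (nbhs_filter _) psiP.
move=> /nbhs_ballP[d /= d0 dP]; exists d => // h hd.
pose chi (t : R) := phi (x + t *: h) - t * 'D_h phi x - 2^-1 * t ^+ 2 * D2 phi x h h.
pose chi' (t : R) := 'D_h phi (x + t *: h) - 'D_h phi x - t * D2 phi x h h.
have dchi (t : R) : is_derive t 1 chi (chi' t).
  have dl : is_derive t 1 (fun t => phi (x + t *: h)) ('D_h phi (x + t *: h)).
    by apply: is_derive_line; apply/derivableP/diff_derivable.
  exact: is_derive_sub_quadratic.
have cchi : continuous chi.
  by move=> t; apply/differentiable_continuous/derivable1_diffP; case: (dchi t).
have [t] := MVT (@ltr01 R) (fun t _ => dchi t) (continuous_subspaceT cchi).
rewrite in_itv/= => /andP[t0 t1]; rewrite subr0 mulr1.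
have -> : chi 1 - chi 0 = phi (x + h) - phi x - 'D_h phi x - 2^-1 * D2 phi x h h.
  by rewrite /chi scale1r scale0r addr0; ring.
move=> ->.
(* The derivative of the second-order remainder along the segment combines the first-order
   remainders of the partial derivatives at [t *: h], which the choice of [d] controls. *)
have -> : chi' t = \sum_i h 0 i * (psi i (x + t *: h) - psi i x - 'D_(t *: h) (psi i) x).
  have Dh y : 'D_h phi y = \sum_i h 0 i * psi i y.
    by rewrite [in LHS](row_basis h) derive_combination.
  have D2h : D2 phi x h h = \sum_i h 0 i * 'D_h (psi i) x.
    by rewrite [X in D2 _ _ _ X](row_basis h) (D2_combinationr _ _ _ d12).
  rewrite /chi' !Dh D2h mulr_sumr -!sumrB; apply: eq_bigr => i _.
  by rewrite (deriveZdir _ _ (d2 _)); ring.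
have thh : `|t *: h| <= `|h| by rewrite normrZ gtr0_norm// ler_piMl// ltW.
apply: le_trans (row_expand_le _ (c := e' * `|h|) _) _ => [i|].
  apply: le_trans (dP (t *: h) _ i) _; last by rewrite ler_pM2l.
  by rewrite -ball_normE /= sub0r normrN (le_lt_trans thh).
rewrite mulrA -mulrA -expr2 ler_wpM2r ?exprn_ge0//.
by rewrite /e' mulrCA ger_pMr// ler_pdivrMr// mul1r lerDl.
Qed.

End derivatives.

(** * Uniform estimates at the parabolic scale *)

Section parabolic_scale.
Context (R : realType) (n : nat) (K : R).
Hypothesis K0 : 0 <= K.
Implicit Types (th psi : R -> 'rV[R]_n -> R).

(* Landau classes for C -> 0^-, uniform on the cap |v| <= K sqrt(-C) that contains
   the slice: [cap_o1] is o(1), [cap_OC] is O(C) and [cap_oC] is o(C). *)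
Definition near_cap (P : R -> 'rV[R]_n -> Prop) :=
  \forall C \near 0^'-, forall v : 'rV[R]_n, `|v| <= K * Num.sqrt (- C) -> P C v.

Definition cap_o1 th := forall e : R, 0 < e -> near_cap (fun C v => `|th C v| <= e).
Definition cap_OC psi := exists A : R, near_cap (fun C v => `|psi C v| <= A * - C).
Definition cap_oC psi := forall e : R, 0 < e -> near_cap (fun C v => `|psi C v| <= e * - C).

Lemma near_left_small (e : R) : 0 < e -> \forall C \near 0^'-, 0 < - C < e.
Proof.
move=> e0; near=> C; apply/andP; split.
  by rewrite oppr_gt0; near: C; exact: nbhs_left_lt.
by rewrite ltrNl; near: C; apply: nbhs_left_gt; rewrite oppr_lt0.
Unshelve. all: by end_near. Qed.

Lemma near_left_sqrt_small (e : R) : 0 < e -> \forall C \near 0^'-, Num.sqrt (- C) < e.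
Proof.
move=> e0; have e20 : 0 < e ^+ 2 by rewrite exprn_gt0.
apply: filterS (near_left_small e20) => C /andP[C0 Ce].
by rewrite -(gtr0_norm e0) -sqrtr_sqr ltr_sqrt.
Qed.

Lemma cap_o1_coord i : cap_o1 (fun _ v => v 0 i).
Proof.
move=> e e0; have eK : 0 < e / (K + 1) by rewrite divr_gt0// ltr_wpDl.
apply: filterS (near_left_sqrt_small eK) => C Ce v vK.
apply: le_trans (row_coord_le v i) _; apply: le_trans vK _.
apply: le_trans (_ : (K + 1) * Num.sqrt (- C) <= _).
  by rewrite ler_wpM2r ?sqrtr_ge0// lerDl.
by rewrite mulrC -ler_pdivlMr ?ltW// ltr_wpDl.
Qed.

Lemma cap_o1_C : cap_o1 (fun C _ => C).
Proof.
move=> e e0; apply: filterS (near_left_small e0) => C /andP[C0 Ce] v _.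
by rewrite ltr0_norm -?oppr_gt0// ltW.
Qed.

Lemma cap_OC_C : cap_OC (fun C _ => C).
Proof.
exists 1; apply: filterS (near_left_small (@ltr01 R)) => C /andP[C0 _] v _.
by rewrite ltr0_norm -?oppr_gt0// mul1r.
Qed.

Lemma cap_OC_coord2 i j : cap_OC (fun _ v => v 0 i * v 0 j).
Proof.
exists (K ^+ 2); apply: filterS (near_left_small (@ltr01 R)) => C /andP[C0 _] v vK.
rewrite normrM -[X in _ <= _ * X](sqr_sqrtr (ltW C0)) -exprMn expr2.
by apply: ler_pM => //; apply: le_trans vK; exact: row_coord_le.
Qed.

Lemma cap_oC_OC psi : cap_oC psi -> cap_OC psi.
Proof. by move=> s; exists 1; exact: s. Qed.

Lemma cap_OCD psi1 psi2 : cap_OC psi1 -> cap_OC psi2 ->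
  cap_OC (fun C v => psi1 C v + psi2 C v).
Proof.
move=> [A1 h1] [A2 h2]; exists (A1 + A2); apply: filterS2 h1 h2 => C h1 h2 v vK.
by rewrite (le_trans (ler_normD _ _))// mulrDl lerD// ?h1 ?h2.
Qed.

Lemma cap_OCZ c psi : cap_OC psi -> cap_OC (fun C v => c * psi C v).
Proof.
move=> [A hA]; exists (`|c| * A); apply: filterS hA => C hA v vK.
by rewrite normrM -mulrA ler_wpM2l// hA.
Qed.

Lemma cap_oCD psi1 psi2 : cap_oC psi1 -> cap_oC psi2 ->
  cap_oC (fun C v => psi1 C v + psi2 C v).
Proof.
move=> s1 s2 e e0; have e20 : 0 < e / 2 by rewrite divr_gt0.
apply: filterS2 (s1 _ e20) (s2 _ e20) => C h1 h2 v vK.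
by rewrite (le_trans (ler_normD _ _))// [e]splitr mulrDl lerD// ?h1 ?h2.
Qed.

Lemma cap_o1_mul_OC th psi : cap_o1 th -> cap_OC psi ->
  cap_oC (fun C v => th C v * psi C v).
Proof.
move=> t1 [A hA] e e0; have eA : 0 < e / (`|A| + 1) by rewrite divr_gt0// ltr_wpDl.
apply: filterS3 (t1 _ eA) hA (near_left_small (@ltr01 R)) => C h1 h2 /andP[C0 _] v vK.
rewrite normrM; apply: le_trans (ler_pM _ _ (h1 v vK) (h2 v vK)) _ => //.
rewrite mulrA ler_pM2r// -mulrA ger_pMr// mulrC ler_pdivrMr ?ltr_wpDl// mul1r.
by rewrite (le_trans (ler_norm _))// lerDl.
Qed.

Lemma cap_OC_sum (I : finType) (psi : I -> R -> 'rV[R]_n -> R) :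
  (forall i, cap_OC (psi i)) -> cap_OC (fun C v => \sum_i psi i C v).
Proof.
move=> s; elim: (index_enum I) => [|i r IH].
  exists 0; near=> C => v _; by rewrite big_nil normr0 mul0r.
have := cap_OCD (s i) IH; congr cap_OC; apply/funext => C; apply/funext => v.
by rewrite big_cons.
Unshelve. all: by end_near. Qed.

Lemma cap_oC_sum (I : finType) (psi : I -> R -> 'rV[R]_n -> R) :
  (forall i, cap_oC (psi i)) -> cap_oC (fun C v => \sum_i psi i C v).
Proof.
move=> s; elim: (index_enum I) => [|i r IH].
  move=> e e0; apply: filterS (near_left_small (@ltr01 R)) => C /andP[C0 _] v _.
  by rewrite big_nil normr0 mulr_ge0// ltW.
have := cap_oCD (s i) IH; congr cap_oC; apply/funext => C; apply/funext => v.
by rewrite big_cons.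
Qed.

Lemma eq_cap_oC psi1 psi2 : (forall C v, psi1 C v = psi2 C v) -> cap_oC psi1 -> cap_oC psi2.
Proof. by move=> e s x x0; apply: filterS (s x x0) => C h v vK; rewrite -e h. Qed.

Lemma eq_cap_OC psi1 psi2 : (forall C v, psi1 C v = psi2 C v) -> cap_OC psi1 -> cap_OC psi2.
Proof. by move=> e [A s]; exists A; apply: filterS s => C h v vK; rewrite -e h. Qed.

Section expansion.
Context (m : nat) (z n0 : 'rV[R]_m) (b : 'I_n -> 'rV[R]_m).

Definition slice_vec (C : R) (v : 'rV[R]_n) : 'rV[R]_m := C *: n0 + \sum_i v 0 i *: b i.

(** For [- C < 1] one has [- C <= sqrt (- C)], so the normal displacement obeys the same bound as
    the tangential one. The 1 added to the constant makes [A] positive, as later divisions by [A]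
    require. *)
Lemma slice_vec_small : exists2 A : R, 0 < A &
  near_cap (fun C v => `|slice_vec C v| <= A * Num.sqrt (- C)).
Proof.
pose B := K * \sum_i `|b i|.
have B0 : 0 <= B by rewrite mulr_ge0// sumr_ge0.
exists (`|n0| + B + 1); first by rewrite ltr_wpDl// addr_ge0.
apply: filterS (near_left_small (@ltr01 R)) => C /andP[C0 C1] v vK.
have sC : - C <= Num.sqrt (- C).
  rewrite -[X in X <= _](sqr_sqrtr (ltW C0)) expr2 ger_pMr ?sqrtr_gt0//.
  by rewrite -sqrtr1 ler_sqrt// ltW.
apply: le_trans (ler_normD _ _) _; apply: le_trans (_ : (`|n0| + B) * Num.sqrt (- C) <= _).
  rewrite mulrDl lerD//.
    by rewrite normrZ ltr0_norm -?oppr_gt0// mulrC ler_wpM2l.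
  rewrite /B mulrAC mulrC mulr_suml; apply: le_trans (ler_norm_sum _ _ _) _.
  apply: ler_sum => i _; rewrite normrZ [leRHS]mulrC ler_wpM2r//.
  by apply: le_trans vK; exact: row_coord_le.
by rewrite ler_wpM2r ?sqrtr_ge0// lerDl.
Qed.

Lemma D2_slice_vec phi (C : R) (v : 'rV[R]_n) : twice_differentiable phi z ->
  D2 phi z (slice_vec C v) (slice_vec C v) = C * (C * D2 phi z n0 n0) +
    C * (\sum_i v 0 i * D2 phi z n0 (b i) + \sum_i v 0 i * D2 phi z (b i) n0) +
    \sum_i \sum_j v 0 i * v 0 j * D2 phi z (b i) (b j).
Proof.
move=> d12; pose w := \sum_i v 0 i *: b i.
transitivity (C * (C * D2 phi z n0 n0) + C * (D2 phi z n0 w + D2 phi z w n0) + D2 phi z w w).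
  rewrite /slice_vec -/w; move: w => w.
  rewrite (D2Dl _ _ _ d12) (D2Zl _ _ _ d12) !(D2Dr _ _ _ d12) !(D2Zr _ _ _ d12).
  move: (D2 _ _ _ _) (D2 _ _ _ _) (D2 _ _ _ _) (D2 _ _ _ _) => A1 A2 A3 A4.
  by rewrite !mulrDr !addrA.
congr (_ + C * (_ + _) + _).
- exact: D2_combinationr.
- exact: D2_combinationl.
- rewrite (D2_combinationl _ _ _ d12); apply: eq_bigr => i _.
  by rewrite (D2_combinationr _ _ _ d12) mulr_sumr; apply: eq_bigr => j _; rewrite mulrA.
Qed.

(** Of the quadratic term only the tangential part survives: the parts involving [n0] carry a factor
    [C ^ 2] or [C * v_i], hence are [o(C)] on the cap. It serves both for [f] and for its
    derivatives ['D_(b k) f]. *)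
Lemma slice_taylor phi : twice_differentiable phi z ->
  cap_oC (fun C v => phi (z + slice_vec C v) -
    (phi z + C * 'D_n0 phi z + \sum_i v 0 i * 'D_(b i) phi z
      + 2^-1 * \sum_i \sum_j v 0 i * v 0 j * D2 phi z (b i) (b j))).
Proof.
move=> d12; have [d1 d2] := d12.
have rem : cap_oC (fun C v => phi (z + slice_vec C v) - phi z - 'D_(slice_vec C v) phi z
    - 2^-1 * D2 phi z (slice_vec C v) (slice_vec C v)).
  have [A A0 hA] := slice_vec_small => e e0.
  have eA : 0 < e / A ^+ 2 by rewrite divr_gt0// exprn_gt0.
  have [d d0 dP] := taylor2_peano d12 eA.
  have dA : 0 < d / A by rewrite divr_gt0.
  apply: filterS3 hA (near_left_sqrt_small dA) (near_left_small (@ltr01 R)).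
  move=> C h1 h2 /andP[C0 _] v /h1 hv.
  apply: le_trans (dP _ _) _.
    by apply: le_lt_trans hv _; rewrite mulrC -ltr_pdivlMr.
  apply: le_trans (_ : e / A ^+ 2 * (A * Num.sqrt (- C)) ^+ 2 <= _).
    by rewrite ler_pM2l// lerXn2r// nnegrE// mulr_ge0 ?sqrtr_ge0// ltW.
  have A2 : A ^+ 2 != 0 by rewrite expf_neq0// gt_eqF.
  by rewrite exprMn (sqr_sqrtr (ltW C0)) mulrA divfK.
have quad : cap_oC (fun C v => C * (C * (2^-1 * D2 phi z n0 n0))).
  apply: cap_o1_mul_OC cap_o1_C _; apply: eq_cap_OC (cap_OCZ (2^-1 * D2 phi z n0 n0) cap_OC_C).
  by move=> C v; rewrite mulrC.
have cross : cap_oC (fun C v =>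
    \sum_i v 0 i * (C * (2^-1 * (D2 phi z n0 (b i) + D2 phi z (b i) n0)))).
  apply: cap_oC_sum => i; apply: cap_o1_mul_OC (cap_o1_coord i) _.
  apply: eq_cap_OC (cap_OCZ (2^-1 * (D2 phi z n0 (b i) + D2 phi z (b i) n0)) cap_OC_C).
  by move=> C v; rewrite mulrC.
apply: eq_cap_oC (cap_oCD rem (cap_oCD quad cross)) => C v.
have alg (p1 p0 p2 Sd Q S1 S2 SS : R) : p1 - p0 - (C * p2 + Sd)
    - 2^-1 * (C * (C * Q) + C * (S1 + S2) + SS)
    + (C * (C * (2^-1 * Q)) + 2^-1 * C * (S1 + S2)) =
    p1 - (p0 + C * p2 + Sd + 2^-1 * SS) by field.
have -> : 'D_(slice_vec C v) phi z = C * 'D_n0 phi z + \sum_i v 0 i * 'D_(b i) phi z.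
  by rewrite deriveDdir// deriveZdir// derive_combination.
have -> : D2 phi z (slice_vec C v) (slice_vec C v) = C * (C * D2 phi z n0 n0) +
    C * (\sum_i v 0 i * D2 phi z n0 (b i) + \sum_i v 0 i * D2 phi z (b i) n0) +
    \sum_i \sum_j v 0 i * v 0 j * D2 phi z (b i) (b j).
  exact: D2_slice_vec.
have -> : \sum_i v 0 i * (C * (2^-1 * (D2 phi z n0 (b i) + D2 phi z (b i) n0))) =
   2^-1 * C * (\sum_i v 0 i * D2 phi z n0 (b i) + \sum_i v 0 i * D2 phi z (b i) n0).
  rewrite -big_split mulr_sumr/=; apply: eq_bigr => i _.
  by move: (D2 _ _ _ _) (D2 _ _ _ _) => X Y; ring.
exact: alg.
Qed.

End expansion.
End parabolic_scale.

(** * Preliminaries on convexity, scalar products and regularity *)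

Lemma convex_set_segment (R : realType) (M : lmodType R) (A : set M) (x y : M) (t : R) :
  @convex_set R M A -> A x -> A y -> 0 <= t <= 1 -> A ((1 - t) *: x + t *: y).
Proof.
move=> cA Ax Ay /andP[t0 t1].
have /(_ (Itv01 t0 t1)) := cA y x _ (mem_set Ay) (mem_set Ax).
by rewrite inE addrC.
Qed.

Section dot.
Context (R : realType) (m : nat).
Implicit Types u v w : 'rV[R]_m.

Lemma dotDr u v w : dot u (v + w) = dot u v + dot u w.
Proof. by rewrite /dot -big_split; apply: eq_bigr => i _; rewrite mxE mulrDr. Qed.

Lemma dotZr (c : R) u v : dot u (c *: v) = c * dot u v.
Proof. by rewrite /dot mulr_sumr; apply: eq_bigr => i _; rewrite mxE mulrCA. Qed.

Lemma dotC u v : dot u v = dot v u.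
Proof. by apply: eq_bigr => i _; rewrite mulrC. Qed.

Lemma dot_sumr (I : finType) u (w : I -> 'rV[R]_m) : dot u (\sum_i w i) = \sum_i dot u (w i).
Proof.
rewrite /dot exchange_big; apply: eq_bigr => j _.
by rewrite summxE mulr_sumr.
Qed.

Lemma dot_combination (I : finType) u (a : I -> R) (w : I -> 'rV[R]_m) :
  dot u (\sum_i a i *: w i) = \sum_i a i * dot u (w i).
Proof. by rewrite dot_sumr; apply: eq_bigr => i _; rewrite dotZr. Qed.

Lemma dot_ge0 u : 0 <= dot u u.
Proof. by apply: sumr_ge0 => i _; rewrite -expr2 sqr_ge0. Qed.

Lemma dot_eq0 u : (dot u u == 0) = (u == 0).
Proof.
apply/eqP/eqP => [|->]; last by rewrite /dot big1// => i _; rewrite mxE mul0r.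
move=> /eqP; rewrite psumr_eq0; last by move=> i _; rewrite -expr2 sqr_ge0.
move=> /allP u0; apply/rowP => i; rewrite mxE; apply/eqP.
by have := u0 i (mem_index_enum i); rewrite mulf_eq0 orbb.
Qed.

Lemma enorm_sqr u : enorm u ^+ 2 = dot u u.
Proof. by rewrite sqr_sqrtr// dot_ge0. Qed.

Lemma enorm_gt0 u : u != 0 -> 0 < enorm u.
Proof. by move=> u0; rewrite sqrtr_gt0 lt_neqAle dot_ge0 eq_sym dot_eq0 u0. Qed.

Lemma dot_grad (phi : 'rV[R]_m -> R) x v : differentiable phi x ->
  dot (grad phi x) v = 'D_v phi x.
Proof.
move=> d; rewrite [in RHS](row_basis v) derive_combination//.
by apply: eq_bigr => i _; rewrite mxE mulrC.
Qed.

End dot.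

Lemma Cn_differentiable (R : realType) m k (phi : 'rV[R]_m -> R) :
  Cn k.+1 phi -> forall x, differentiable phi x.
Proof. by case. Qed.

Lemma Cn_derive (R : realType) m k (phi : 'rV[R]_m -> R) v :
  Cn k.+1 phi -> Cn k (fun x => 'D_v phi x).
Proof. by case=> _; apply. Qed.

Lemma Cn_twice (R : realType) m k (phi : 'rV[R]_m -> R) :
  Cn k.+2 phi -> forall x, twice_differentiable phi x.
Proof.
move=> h x; split; first exact: Cn_differentiable h.
by move=> v; exact: (Cn_differentiable (Cn_derive v h)).
Qed.

Lemma differentiable_cont (R : realType) m (phi : 'rV[R]_m -> R) :
  (forall x, differentiable phi x) -> continuous phi.
Proof. by move=> d x; exact: differentiable_continuous. Qed.

(** [lam] is the minimum of the form on the compact unit sphere, which is nonempty since [n > 0];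
    homogeneity of degree 2 gives the rest. *)
Lemma qform_coercive (R : realType) n (H : 'I_n -> 'I_n -> R) : (0 < n)%N ->
  (forall v, v != 0 -> 0 < qform H v) ->
  exists2 lam : R, 0 < lam & forall v, lam * `|v| ^+ 2 <= qform H v.
Proof.
move=> n0 Hpos.
have cS : compact [set v : 'rV[R]_n | `|v| = 1].
  apply: bounded_closed_compact.
    by exists 1; split => [|x x1 v /= ->]; [exact: num_real|exact: ltW].
  have -> : [set v : 'rV[R]_n | `|v| = 1] = Num.norm @^-1` [set 1] by [].
  exact: (iffLR (continuous_closedP _) (@norm_continuous _ _) _ (@closed_eq R 1)).
have S0 : [set v : 'rV[R]_n | `|v| = 1] !=set0.
  pose e : 'rV[R]_n := const_mx 1; exists e => /=; apply/le_anti/andP; split.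
    by apply: row_norm_le => // i; rewrite mxE normr1.
  by have := row_coord_le e (Ordinal n0); rewrite mxE normr1.
have [c /set_mem/= c1 cmin] := EVT_min_rV S0 cS (continuous_subspaceT (@continuous_qform R n H)).
exists (qform H c).
  by apply: Hpos; rewrite -normr_eq0 c1 oner_eq0.
move=> v; have [->|v0] := eqVneq v 0.
  rewrite normr0 expr0n mulr0 /qform big1// => i _; rewrite big1// => j _.
  by rewrite !mxE !mul0r.
have nv : 0 < `|v| by rewrite normr_gt0.
rewrite -ler_pdivlMr ?exprn_gt0//.
have -> : qform H v / `|v| ^+ 2 = qform H (`|v|^-1 *: v).
  rewrite /qform mulr_suml; apply: eq_bigr => i _; rewrite mulr_suml; apply: eq_bigr => j _.
  by rewrite !mxE expr2 invfM; ring.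
by apply: cmin; rewrite inE /= normrZ normfV normr_id mulVf// gt_eqF.
Qed.

(** * The slices *)

Section slices.
Context (R : realType) (n : nat) (f : 'rV[R]_n.+1 -> R) (z : 'rV[R]_n.+1).
Context (b : 'I_n -> 'rV[R]_n.+1).
Hypothesis hf : Cn 4 f.
Hypothesis hgrad : grad f z != 0.
Hypothesis hb : tangent_frame (grad f z) b.

(** Scaled so that [Pfun] grows at unit rate along it: [z + C *: normal_step] lies on the hyperplane
    of height [C] and is the base point used by [slice_centroid]. *)
Definition normal_step : 'rV[R]_n.+1 := (enorm (grad f z) ^+ 2)^-1 *: grad f z.

Local Notation n0 := normal_step.
Local Notation point C v := (z + slice_vec normal_step b C v).

Definition slice_fun (C : R) (v : 'rV[R]_n) : R := f (point C v) - f z.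

Definition slice_partial (k : 'I_n) (C : R) (v : 'rV[R]_n) : R := 'D_(b k) f (point C v).

Lemma twice_f x : twice_differentiable f x.
Proof. exact: (Cn_twice hf). Qed.

Lemma twice_Df w x : twice_differentiable (fun y => 'D_w f y) x.
Proof. exact: (Cn_twice (Cn_derive w hf)). Qed.

Lemma derive_normal_step : 'D_n0 f z = 1.
Proof.
have [d1 _] := twice_f z.
rewrite -dot_grad// /normal_step dotZr -enorm_sqr mulVf// expf_neq0//.
by rewrite gt_eqF// enorm_gt0.
Qed.

Lemma derive_frame i : 'D_(b i) f z = 0.
Proof. by rewrite -dot_grad; [case: hb|case: (twice_f z)]. Qed.

Lemma slice_fun_taylor K : 0 <= K ->
  cap_oC K (fun C v => slice_fun C v
    - (C + 2^-1 * qform (fun i j => D2 f z (b i) (b j)) v)).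
Proof.
move=> K0; apply: eq_cap_oC (slice_taylor K0 n0 b (twice_f z)) => C v.
rewrite derive_normal_step mulr1 big1 => [|i _]; last by rewrite derive_frame mulr0.
rewrite addr0 /slice_fun /qform; move: (f _) (f z) (\sum_i _) => *; ring.
Qed.

(** [D3 f] with [b k] in last position is by definition [D2] of ['D_(b k) f], so the second-order
    expansion of that derivative brings in the third derivatives of [f]. *)
Lemma slice_partial_taylor K k : 0 <= K ->
  cap_oC K (fun C v => slice_partial k C v -
    (C * D2 f z n0 (b k) + \sum_i v 0 i * D2 f z (b i) (b k)
      + 2^-1 * qform (fun i j => D3 f z (b i) (b j) (b k)) v)).
Proof.
move=> K0; apply: eq_cap_oC (slice_taylor K0 n0 b (twice_Df (b k) z)) => C v.
by rewrite derive_frame add0r.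
Qed.

Lemma continuous_slice_vec C : continuous (fun v => point C v).
Proof.
have cs : continuous (fun v : 'rV[R]_n => \sum_i v 0 i *: b i).
  apply: continuous_sum => i w.
  exact: (cvgZ (@coord_continuous R 1 n 0 i w) (cvg_cst (b i))).
move=> v; exact: (cvgD (cvg_cst z) (cvgD (cvg_cst (C *: n0)) (cs v))).
Qed.

Lemma continuous_slice_fun C : continuous (slice_fun C).
Proof.
have cf := differentiable_cont (Cn_differentiable hf).
move=> v; exact: (cvgB (continuous_comp (@continuous_slice_vec C v) (cf _)) (cvg_cst (f z))).
Qed.

Lemma continuous_slice_partial k C : continuous (slice_partial k C).
Proof.
have cf := differentiable_cont (Cn_differentiable (Cn_derive (b k) hf)).
by move=> v; exact: (continuous_comp (@continuous_slice_vec C v) (cf _)).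
Qed.

Lemma point_shift C v k (t : R) : point C (t *: delta_mx 0 k + v) = t *: b k + point C v.
Proof.
have E : \sum_i (t *: delta_mx 0 k + v) 0 i *: b i = t *: b k + \sum_i v 0 i *: b i.
  rewrite -[t *: b k]addr0 (bigD1 k)//= [in RHS](bigD1 k)//= !mxE !eqxx mulr1 scalerDl.
  rewrite addr0 -addrA; congr (_ + (_ + _)).
  by apply: eq_bigr => i ik; rewrite !mxE (negbTE ik) mulr0 add0r.
by rewrite /slice_vec E (addrCA (C *: n0)) (addrCA z).
Qed.

Lemma is_derive_slice_fun k C v :
  is_derive v (delta_mx 0 k) (slice_fun C) (slice_partial k C v).
Proof.
have dfx : derivable f (point C v) (b k).
  by apply: diff_derivable; exact: (Cn_differentiable hf).
have eqf : (fun h : R => h^-1 *: ((slice_fun C \o shift v) (h *: delta_mx 0 k) - slice_fun C v)) =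
    (fun h => h^-1 *: ((f \o shift (point C v)) (h *: b k) - f (point C v))).
  apply/funext => h /=; rewrite /slice_fun point_shift; congr (_ *: _).
  by rewrite opprB addrA subrK.
by split; [rewrite /derivable eqf|rewrite /slice_partial /derive eqf].
Qed.

Lemma flat_param_point C u :
  flat_param (z + (C / enorm (grad f z) ^+ 2) *: grad f z) b u = point C (row_of_tuple u).
Proof.
rewrite /flat_param /slice_vec /normal_step scalerA addrA; congr (_ + _).
by apply: eq_bigr => i _; rewrite mxE.
Qed.

Lemma Pfun_point C v : Defs.Pfun f z (point C v) = C.
Proof.
rewrite /Defs.Pfun addrC addKr /slice_vec dotDr dotZr dot_combination big1 => [|i _]; last first.
  by case: hb => _ ->; rewrite mulr0.
by rewrite addr0 dot_grad ?derive_normal_step ?mulr1//; case: (twice_f z).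
Qed.

Lemma slice_point C v : slice f z C (point C v) <-> slice_fun C v <= 0.
Proof.
rewrite /slice /slice_fun /hyperplane /= Pfun_point subr_le0; split => [[]//|]; by split.
Qed.

Lemma slice_fun_convex C : convex_body (hyperplane f z C) (slice f z C) ->
  sublevel_convex (slice_fun C).
Proof.
move=> [_ _ cS _] v w t /slice_point Sv /slice_point Sw t01; apply/slice_point.
have -> : point C (v + t *: (w - v)) = (1 - t) *: point C v + t *: point C w; last first.
  exact: convex_set_segment.
have E : \sum_i (v + t *: (w - v)) 0 i *: b i =
    (1 - t) *: (\sum_i v 0 i *: b i) + t *: (\sum_i w 0 i *: b i).
  rewrite !scaler_sumr -big_split; apply: eq_bigr => i _ /=.
  by rewrite !mxE !scalerA -scalerDl; congr (_ *: _); ring.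
have comb (w' : 'rV[R]_n.+1) : (1 - t) *: w' + t *: w' = w'.
  by rewrite -scalerDl subrK scale1r.
by rewrite /slice_vec E !scalerDr addrACA comb [in X in _ = _ + X]addrACA comb.
Qed.

Lemma slice_fun_base : \forall C \near 0^'-, slice_fun C 0 < 0.
Proof.
have h2 : 0 < 2^-1 :> R by rewrite invr_gt0.
(* With [K = 0] the cap is the single point 0, where the expansion gives [F <= C - C / 2 < 0]. *)
have := slice_fun_taylor (lexx 0) h2.
apply: filterS2 (near_left_small (@ltr01 R)) => C /andP[C0 _] /(_ 0).
rewrite normr0 mul0r lexx => /(_ isT).
have -> : qform (fun i j => D2 f z (b i) (b j)) 0 = 0.
  by rewrite /qform big1// => i _; rewrite big1// => j _; rewrite !mxE !mul0r.
rewrite mulr0 addr0 => /(le_trans (ler_norm _)) h.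
by move: (slice_fun C 0) h C0 => y h C0; lra.
Qed.

End slices.

(** * Averaged identities for the moments *)

Lemma is_derive_coord (R : realType) n (v e : 'rV[R]_n) (j : 'I_n) :
  is_derive v e (fun w => w 0 j) (e 0 j).
Proof.
split; first exact: ((derivable_mxP id v e).1 (@derivable_id _ _ v e) 0 j).
have := @derive_mx R 'rV[R]_n 1 n id v e (@derivable_id _ _ v e).
by rewrite derive_id => E; rewrite [in RHS]E mxE.
Qed.

Section moments.
Context (R : realType) (n : nat) (f : 'rV[R]_n.+1 -> R) (z : 'rV[R]_n.+1).
Context (b : 'I_n -> 'rV[R]_n.+1).
Hypothesis n_gt0 : (0 < n)%N.
Hypothesis hf : Cn 4 f.
Hypothesis hgrad : grad f z != 0.
Hypothesis hb : tangent_frame (grad f z) b.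
Hypothesis hconv : forall v : 'rV[R]_n.+1,
  v != 0 -> dot (grad f z) v = 0 -> 0 < D2 f z v v.
Hypothesis hbody : \forall C \near 0^'-, convex_body (hyperplane f z C) (slice f z C).

Local Notation H := (fun i j => D2 f z (b i) (b j)).
Local Notation F := (slice_fun f z b).

Lemma frame_qform_gt0 v : v != 0 -> 0 < qform H v.
Proof.
move=> v0; pose w := \sum_i v 0 i *: b i.
have -> : qform H v = D2 f z w w.
  rewrite (D2_combinationl _ _ _ (twice_f hf z)); apply: eq_bigr => i _.
  by rewrite (D2_combinationr _ _ _ (twice_f hf z)) mulr_sumr; apply: eq_bigr => j _; rewrite mulrA.
have [ob nb] := hb.
apply: hconv; last by rewrite dot_combination big1// => i _; rewrite nb mulr0.
apply: contra_neq v0 => w0; apply/rowP => i; rewrite mxE.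
have : dot (b i) w = v 0 i.
  rewrite dot_combination (bigD1 i)//= ob eqxx mulr1 big1 ?addr0// => j ji.
  by rewrite ob eq_sym (negbTE ji) mulr0.
by rewrite w0 => <-; rewrite /dot big1// => j _; rewrite mxE mulr0.
Qed.

(** On the sphere [|v| = K sqrt (- C)] the expansion gives [F > 0], while [F < 0] at 0. A point of
    the slice beyond the sphere would, by convexity, put the whole segment joining it to 0 into the
    slice, including the point [t *: v] where that segment meets the sphere. *)
Lemma slice_fun_confined : exists2 K : R, 0 <= K &
  \forall C \near 0^'-, forall v, F C v <= 0 -> `|v| <= K * Num.sqrt (- C).
Proof.
have [lam lam0 hlam] := qform_coercive n_gt0 frame_qform_gt0.
(* With [lam * K ^ 2 = 4], half the quadratic form is at least [- 2 C] on the sphere, which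
   outweighs both the term [C] and an error of [- C / 2]. *)
pose K := 2 / Num.sqrt lam.
have sl0 : 0 < Num.sqrt lam by rewrite sqrtr_gt0.
have K0 : 0 < K by rewrite divr_gt0.
have K2 : lam * K ^+ 2 = 4.
  rewrite /K expr_div_n sqr_sqrtr ?ltW// mulrCA divff ?gt_eqF//; ring.
exists K; first exact: ltW.
have h2 : 0 < 2^-1 :> R by rewrite invr_gt0.
have T := slice_fun_taylor hf hgrad hb (ltW K0) h2.
apply: filter_app (near_left_small (@ltr01 R)); apply: filter_app hbody; apply: filter_app T.
apply: filterS (slice_fun_base hf hgrad hb) => C F0 T bodyC /andP[C0 _] v Fv.
rewrite leNgt; apply/negP => vK.
have s0 : 0 < Num.sqrt (- C) by rewrite sqrtr_gt0.
have v0 : 0 < `|v| by apply: lt_trans vK; rewrite mulr_gt0.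
pose t := K * Num.sqrt (- C) / `|v|.
have t01 : 0 <= t <= 1.
  apply/andP; split; first by rewrite divr_ge0// mulr_ge0 ?ltW.
  by rewrite /t ler_pdivrMr// mul1r ltW.
have := slice_fun_convex hf hgrad hb bodyC (ltW F0) Fv t01.
rewrite add0r subr0 leNgt => /negP; apply.
have tv : `|t *: v| = K * Num.sqrt (- C).
  by rewrite normrZ ger0_norm ?divfK ?gt_eqF//; case/andP: t01.
have := T (t *: v); rewrite tv lexx => /(_ isT).
have := hlam (t *: v); rewrite tv exprMn (sqr_sqrtr (ltW C0)) mulrA K2.
move: (F C _) (qform _ _) => y q qC; rewrite ler_norml => /andP[h _].
by lra.
Qed.

Local Notation E C := (sublevel_mean (F C)).

Lemma slice_mean_on K :
  (\forall C \near 0^'-, forall v, F C v <= 0 -> `|v| <= K * Num.sqrt (- C)) ->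
  \forall C \near 0^'-, mean_on (F C) (E C).
Proof.
move=> hK; apply: filter_app hK; apply: filter_app hbody.
apply: filterS (slice_fun_base hf hgrad hb) => C F0 bodyC FK.
apply: (@sublevel_mean_on _ _ _ (K * Num.sqrt (- C)) 0) => //.
- exact: continuous_slice_fun.
- exact: (slice_fun_convex hf hgrad hb bodyC).
- by move=> v Fv i; apply: le_trans (row_coord_le v i) (FK v Fv).
Qed.

(** The passage from uniform estimates to limits: the slice lies in the cap, so an [o(C)] function
    has an [o(C)] average, and dividing by [- C] leaves [o(1)]. *)
Lemma mean_cap_oC K (psi : R -> 'rV[R]_n -> R) (X : R -> R) :
  (\forall C \near 0^'-, forall v, F C v <= 0 -> `|v| <= K * Num.sqrt (- C)) ->
  cap_oC K psi -> (forall C, continuous (psi C)) ->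
  (forall C, C < 0 -> mean_on (F C) (E C) -> X C * - C = E C (psi C)) ->
  X C @[C --> 0^'-] --> 0.
Proof.
move=> hK psio cpsi XE; apply/cvgr0Pnorm_le => e e0.
have hM := slice_mean_on hK.
apply: filter_app (psio e e0); apply: filter_app hK; apply: filter_app hM.
apply: filterS (near_left_small (@ltr01 R)) => C /andP[C0 _] mE hK psiC.
have C0' : C < 0 by rewrite -oppr_gt0.
rewrite -(ler_pM2r C0) -[X in _ * X <= _](gtr0_norm C0) -normrM XE//.
by apply: (mean_le mE) => // v /hK /psiC.
Qed.

Definition second_moment i j C := E C (fun v => v 0 i * v 0 j) / - C.
Definition first_moment i C := E C (fun v => v 0 i) / - C.
Definition mean_height C := E C (F C) / - C.

Local Notation M := second_moment.

Lemma mean_height_cvg :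
  mean_height C - (2^-1 * (\sum_i \sum_j H i j * M i j C) - 1) @[C --> 0^'-] --> 0.
Proof.
have [K K0 hK] := slice_fun_confined.
have cq := continuous_scale_fun (c := 2^-1) (@continuous_qform R n H).
have cQ C : continuous (fun v => C + 2^-1 * qform H v).
  exact: (continuous_add_fun (@continuous_cst_fun R n C) cq).
have cF C : continuous (F C) by exact: continuous_slice_fun.
apply: (mean_cap_oC hK (slice_fun_taylor hf hgrad hb K0)) => [C|C C0 mE].
  exact: (continuous_sub_fun (cF C) (cQ C)).
rewrite (meanB mE (cF C) (cQ C)) (meanD mE (@continuous_cst_fun R n C) cq) (mean_cst mE).
rewrite (meanZ mE _ (@continuous_qform R n H)) (mean_qform mE).
have -> : \sum_i \sum_j H i j * M i j C =
    (\sum_i \sum_j H i j * E C (fun v => v 0 i * v 0 j)) / - C.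
  rewrite mulr_suml; apply: eq_bigr => i _; rewrite mulr_suml.
  by apply: eq_bigr => j _; rewrite mulrA.
rewrite /mean_height; move: (E C (F C)) (\sum_i \sum_j _) => x y.
by field; rewrite lt_eqF.
Qed.

(** Integration by parts for [v_j F] balances [(j == k) E F] against the average of [v_j d_k F].
    Keeping [mean_height] as an unknown makes these relations linear. *)
Lemma second_moment_cvg0 j k :
  - (j == k)%:R * mean_height C - \sum_i H i k * M j i C @[C --> 0^'-] --> 0.
Proof.
have [K K0 hK] := slice_fun_confined.
pose L (v : 'rV[R]_n) := \sum_i v 0 i * H i k.
have cL : continuous L by exact: continuous_linear_row.
have cF C : continuous (F C) by exact: continuous_slice_fun.
have cP C : continuous (slice_partial f z b k C) by exact: continuous_slice_partial.
have cvP C := continuous_mul_fun (@continuous_coord_fun R n j) (cP C).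
have cvL := continuous_mul_fun (@continuous_coord_fun R n j) cL.
(* Apart from [L], every term of [d_k F] is [O(C)] on the cap, and multiplication by [v_j = o(1)]
   makes it negligible. *)
have psio : cap_oC K (fun C v => v 0 j * slice_partial f z b k C v - v 0 j * L v).
  have := cap_oC_OC (slice_partial_taylor hf hb k K0).
  have OD := cap_OCZ (D2 f z (normal_step f z) (b k)) (@cap_OC_C R n K).
  have OT : cap_OC K (fun (_ : R) v => 2^-1 * qform (fun i l => D3 f z (b i) (b l) (b k)) v).
    apply: cap_OCZ; apply: cap_OC_sum => i; apply: cap_OC_sum => l.
    have := cap_OCZ (D3 f z (b i) (b l) (b k)) (cap_OC_coord2 K i l).
    by apply: eq_cap_OC => C v; rewrite mulrC.
  move=> OR; have := cap_o1_mul_OC (cap_o1_coord K0 j) (cap_OCD OR (cap_OCD OD OT)).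
  apply: eq_cap_oC => C v; rewrite -mulrBr; congr (_ * _); rewrite /L.
  move: (slice_partial _ _ _ _ _ _) (D2 _ _ _ _) (\sum_i _) (2^-1 * _) => x y S T; ring.
apply: (mean_cap_oC hK psio) => [C|C C0 mE].
  exact: (continuous_sub_fun (cvP C) cvL).
rewrite (meanB mE (cvP C) cvL).
have EL : E C (fun v : 'rV[R]_n => v 0 j * L v) = \sum_i H i k * E C (fun v => v 0 j * v 0 i).
  have -> : (fun v : 'rV[R]_n => v 0 j * L v) = (fun v => \sum_i H i k * (v 0 j * v 0 i)).
    apply/funext => v; rewrite /L mulr_sumr; apply: eq_bigr => i _.
    by rewrite mulrA mulrC.
  rewrite (mean_sum mE (g := fun i (v : 'rV[R]_n) => H i k * (v 0 j * v 0 i))).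
    by apply: eq_bigr => i _; rewrite (meanZ mE)//; exact: continuous_coord2.
  by move=> i; exact: (continuous_scale_fun (continuous_coord2 (i := j) (j := i))).
have EP : (j == k)%:R * E C (F C) + E C (fun v => v 0 j * slice_partial f z b k C v) = 0.
  rewrite -(meanZ mE _ (cF C)) -(meanD mE (continuous_scale_fun (cF C)) (cvP C)).
  apply: (mean_derive mE (k := k) (G := fun v : 'rV[R]_n => v 0 j * F C v)).
  - move=> v; have dv := is_derive_coord v (delta_mx 0 k) j.
    have dF : is_derive v (delta_mx 0 k) (F C) (slice_partial f z b k C v).
      exact: is_derive_slice_fun.
    have := is_deriveM dv dF; rewrite mxE eqxx /= eq_sym => h.
    apply: is_derive_eq h _; rewrite addrC; congr (_ + _).
    by rewrite mulrC eq_sym.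
  - exact: (continuous_add_fun (continuous_scale_fun (cF C)) (cvP C)).
  - by move=> v ->; rewrite mulr0.
have -> : \sum_i H i k * M j i C = (\sum_i H i k * E C (fun v => v 0 j * v 0 i)) / - C.
  by rewrite mulr_suml; apply: eq_bigr => i _; rewrite mulrA.
have -> : E C (fun v : 'rV[R]_n => v 0 j * slice_partial f z b k C v) =
    - ((j == k)%:R * E C (F C)) by apply/eqP; rewrite -addr_eq0 addrC EP.
rewrite EL /mean_height.
move: (E C (F C)) (\sum_i _) (_%:R) => x y d.
by field; rewrite lt_eqF.
Qed.

(** The average of [d_k F] is exactly zero, so averaging its second-order expansion and dividing by
    [- C] ties the first moments to the second ones. *)
Lemma first_moment_cvg0 k :
  D2 f z (normal_step f z) (b k) - \sum_i H i k * first_moment i C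
   - 2^-1 * (\sum_i \sum_j D3 f z (b i) (b j) (b k) * M i j C) @[C --> 0^'-] --> 0.
Proof.
have [K K0 hK] := slice_fun_confined.
pose L (v : 'rV[R]_n) := \sum_i v 0 i * H i k.
pose T i j := D3 f z (b i) (b j) (b k).
have cL : continuous L by exact: continuous_linear_row.
have cP C : continuous (slice_partial f z b k C) by exact: continuous_slice_partial.
have cq := continuous_scale_fun (c := 2^-1) (@continuous_qform R n T).
pose D := D2 f z (normal_step f z) (b k).
have cDL C : continuous (fun v => C * D + L v).
  exact: (continuous_add_fun (@continuous_cst_fun R n (C * D)) cL).
have cQ C : continuous (fun v => C * D + L v + 2^-1 * qform T v).
  exact: (continuous_add_fun (cDL C) cq).
apply: (mean_cap_oC hK (slice_partial_taylor hf hb k K0)) => [C|C C0 mE].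
  exact: (continuous_sub_fun (cP C) (cQ C)).
rewrite (meanB mE (cP C) (cQ C)) (meanD mE (cDL C) cq).
rewrite (meanD mE (@continuous_cst_fun R n (C * D)) cL) (mean_cst mE).
rewrite (meanZ mE _ (@continuous_qform R n T)) (mean_qform mE) (mean_linear mE).
have -> : E C (slice_partial f z b k C) = 0.
  apply: (mean_derive mE (k := k) (G := F C)) => // v.
  exact: is_derive_slice_fun.
have -> : \sum_i \sum_j D3 f z (b i) (b j) (b k) * M i j C =
    (\sum_i \sum_j T i j * E C (fun v => v 0 i * v 0 j)) / - C.
  rewrite mulr_suml; apply: eq_bigr => i _; rewrite mulr_suml.
  by apply: eq_bigr => j _; rewrite mulrA.
have -> : \sum_i H i k * first_moment i C = (\sum_i H i k * E C (fun v => v 0 i)) / - C.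
  by rewrite mulr_suml; apply: eq_bigr => i _; rewrite mulrA.
rewrite -/D; move: (\sum_i _) (\sum_i \sum_j _) => x y.
by field; rewrite lt_eqF.
Qed.

End moments.

(** * Limits of the moments *)

Lemma cvg_sum_fin (R : realType) (V : normedModType R) (T : Type) (G : set_system T)
    (FG : Filter G) (I : finType) (g : I -> T -> V) (a : I -> V) :
  (forall i, g i x @[x --> G] --> a i) -> \sum_i g i x @[x --> G] --> \sum_i a i.
Proof.
move=> ga; elim: (index_enum I) => [|i r IH].
  rewrite big_nil; under eq_fun do rewrite big_nil; exact: cvg_cst.
rewrite big_cons; under eq_fun do rewrite big_cons; exact: (cvgD (ga i) IH).
Qed.

Section limits.
Context (R : realType) (n : nat) (f : 'rV[R]_n.+1 -> R) (z : 'rV[R]_n.+1).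
Context (b : 'I_n -> 'rV[R]_n.+1).
Hypothesis n_gt0 : (0 < n)%N.
Hypothesis hf : Cn 4 f.
Hypothesis hgrad : grad f z != 0.
Hypothesis hb : tangent_frame (grad f z) b.
Hypothesis hconv : forall v : 'rV[R]_n.+1,
  v != 0 -> dot (grad f z) v = 0 -> 0 < D2 f z v v.
Hypothesis hbody : \forall C \near 0^'-, convex_body (hyperplane f z C) (slice f z C).

Local Notation H := (fun i j => D2 f z (b i) (b j)).
Local Notation M := (second_moment f z b).
Local Notation Hinv := (invmx (tangent_hessian f z b)).

Lemma tangent_hessian_unit : tangent_hessian f z b \in unitmx.
Proof.
rewrite unitmxE unitfE; apply/det0P => -[v v0 vH].
have := frame_qform_gt0 hf hb hconv v0.
have -> : qform H v = \sum_j (v *m tangent_hessian f z b) 0 j * v 0 j.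
  rewrite /qform exchange_big; apply: eq_bigr => j _; rewrite mxE mulr_suml.
  by apply: eq_bigr => i _; rewrite mxE mulrAC.
by rewrite vH big1 ?ltxx// => j _; rewrite mxE mul0r.
Qed.

Lemma second_momentC i j C : M i j C = M j i C.
Proof.
rewrite /second_moment (_ : (fun v : 'rV[R]_n => v 0 i * v 0 j) = (fun v => v 0 j * v 0 i))//.
by apply/funext => v; rewrite mulrC.
Qed.

(** The moment identities control [x H] rather than [x]; this form recovers [x] by a finite sum,
    through which limits pass. *)
Lemma mulmx_invl (x : 'I_n -> R) l :
  x l = \sum_k (\sum_i x i * H i k) * Hinv k l.
Proof.
have E : (\row_i x i) *m tangent_hessian f z b *m Hinv = \row_i x i.
  by rewrite -mulmxA mulmxV ?mulmx1// tangent_hessian_unit.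
have := congr1 (fun A : 'rV_n => A 0 l) E; rewrite !mxE => <-.
apply: eq_bigr => k _; congr (_ * _); rewrite mxE; apply: eq_bigr => i _.
by rewrite !mxE.
Qed.

Lemma mean_height_lim : mean_height f z b C @[C --> 0^'-] --> (- (2 / n.+2%:R) : R).
Proof.
have h0 := mean_height_cvg n_gt0 hf hgrad hb hconv hbody.
have s0 := second_moment_cvg0 n_gt0 hf hgrad hb hconv hbody.
pose Y k C := - (k == k)%:R * mean_height f z b C - \sum_i H i k * M k i C.
pose X C := mean_height f z b C - (2^-1 * (\sum_i \sum_j H i j * M i j C) - 1).
have sY : \sum_k Y k C @[C --> 0^'-] --> (0 : R).
  by rewrite -[X in _ --> X](@big1 R 0 +%R _ (index_enum 'I_n) xpredT (fun=> 0))//;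
    apply: cvg_sum_fin => k; exact: s0.
(* With [h] the mean height and [s = tr(HM)], [2 X = 2 h - s + 2] and the sum of the [Y k] is
   [- n h - s]; eliminating [s] leaves [(n + 2) h], the source of the constant [n + 2]. *)
have E C : mean_height f z b C = (2 * X C - \sum_k Y k C - 2) / n.+2%:R.
  have -> : \sum_k Y k C = - n%:R * mean_height f z b C - \sum_i \sum_j H i j * M i j C.
    have eY : \sum_(k < n) - (k == k)%:R * mean_height f z b C = - n%:R * mean_height f z b C.
      under eq_bigr do rewrite eqxx mulN1r.
      by rewrite sumr_const card_ord -[LHS]mulr_natl mulrN mulNr.
    have MY : \sum_k \sum_i H i k * M k i C = \sum_i \sum_j H i j * M i j C.
      rewrite [LHS]exchange_big; apply: eq_bigr => i _; apply: eq_bigr => j _.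
      congr (_ * _); exact: second_momentC.
    rewrite /Y sumrB; exact: (congr2 (fun x y => x - y) eY MY).
  rewrite /X; move: (mean_height f z b C) (\sum_i _) => e t.
  have n2 : (n.+2%:R : R) = n%:R + 2 by rewrite -addn2 natrD.
  have n20 : n%:R + 2 != 0 :> R by rewrite -n2 pnatr_eq0.
  by rewrite n2; field.
have -> : - (2 / n.+2%:R) = (2 * 0 - 0 - 2) / n.+2%:R :> R.
  by rewrite mulr0 subr0 add0r mulNr.
rewrite (_ : mean_height f z b = fun C => (2 * X C - \sum_k Y k C - 2) / n.+2%:R); last first.
  exact/funext.
have hX : X C @[C --> 0^'-] --> (0 : R) by exact: h0.
have h1 : 2 * X C @[C --> 0^'-] --> (2 * 0 : R) by apply: cvgM hX; exact: cvg_cst.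
have h2 : 2 * X C - \sum_k Y k C @[C --> 0^'-] --> (2 * 0 - 0 : R) by exact: (cvgB h1 sY).
have h3 : 2 * X C - \sum_k Y k C - 2 @[C --> 0^'-] --> (2 * 0 - 0 - 2 : R).
  by apply: cvgB h2 _; exact: cvg_cst.
by apply: cvgM h3 _; exact: cvg_cst.
Qed.

Lemma second_moment_lim j l : M j l C @[C --> 0^'-] --> (2 / n.+2%:R * Hinv j l : R).
Proof.
have hH k : \sum_i M j i C * H i k @[C --> 0^'-] --> ((j == k)%:R * (2 / n.+2%:R) : R).
  have s0 := second_moment_cvg0 n_gt0 hf hgrad hb hconv hbody j k.
  pose d : R := - (j == k)%:R; pose S C := \sum_i H i k * M j i C.
  have s1 : d * mean_height f z b C - S C @[C --> 0^'-] --> (0 : R) by exact: s0.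
  have h0 : d * mean_height f z b C @[C --> 0^'-] --> (d * - (2 / n.+2%:R) : R).
    by apply: cvgM mean_height_lim; exact: cvg_cst.
  have h : d * mean_height f z b C - (d * mean_height f z b C - S C) @[C --> 0^'-] -->
      (d * - (2 / n.+2%:R) - 0 : R) by exact: (cvgB h0 s1).
  rewrite subr0 mulrNN in h.
  rewrite (_ : (fun C => \sum_i M j i C * H i k) =
    (fun C => d * mean_height f z b C - (d * mean_height f z b C - S C)))//.
  apply/funext => C; rewrite opprB addrC subrK.
  by apply: eq_bigr => i _; rewrite mulrC.
rewrite (_ : M j l = fun C => \sum_k (\sum_i M j i C * H i k) * Hinv k l); last first.
  apply/funext => C; exact: (mulmx_invl (fun i => M j i C)).
rewrite (_ : _ * Hinv j l = \sum_k (j == k)%:R * (2 / n.+2%:R) * Hinv k l); last first.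
  rewrite (bigD1 j)//= eqxx mul1r big1 ?addr0// => k kj.
  by rewrite eq_sym (negbTE kj) !mul0r.
by apply: cvg_sum_fin => k; apply: cvgM (hH k) _; exact: cvg_cst.
Qed.

(* The limit of the symmetric second moments is a multiple of [Hinv], so Schwarz's
   theorem on mixed derivatives is not needed. *)
Lemma invmx_hessian_sym i j : Hinv i j = Hinv j i.
Proof.
have n20 : 2 / n.+2%:R != 0 :> R by rewrite mulf_neq0 ?invr_eq0 ?pnatr_eq0.
apply: (mulfI n20).
have E : M i j = M j i by apply/funext => C; exact: second_momentC.
have := @second_moment_lim i j; rewrite E => /(cvg_lim (@Rhausdorff R)) <-.
by apply: cvg_lim => //; exact: second_moment_lim.
Qed.

(** The limit of the k-th entry of [m H]. The coefficient [1 / (n + 2)] is the Taylor factor [1 / 2]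
    times the factor [2 / (n + 2)] of the second moments. *)
Definition moment_load k : R := D2 f z (normal_step f z) (b k)
  - n.+2%:R^-1 * \sum_i \sum_j Hinv i j * D3 f z (b i) (b j) (b k).

Lemma first_moment_lim l :
  first_moment f z b l C @[C --> 0^'-] --> \sum_k moment_load k * Hinv k l.
Proof.
have hH k : \sum_i first_moment f z b i C * H i k @[C --> 0^'-] --> moment_load k.
  have s0 := first_moment_cvg0 n_gt0 hf hgrad hb hconv hbody k.
  have hT : \sum_i \sum_j D3 f z (b i) (b j) (b k) * M i j C @[C --> 0^'-] -->
      \sum_i \sum_j D3 f z (b i) (b j) (b k) * (2 / n.+2%:R * Hinv i j).
    apply: cvg_sum_fin => i; apply: cvg_sum_fin => j.
    by apply: cvgM (@second_moment_lim i j); exact: cvg_cst.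
  pose d := D2 f z (normal_step f z) (b k).
  pose S C := \sum_i H i k * first_moment f z b i C.
  pose T C := 2^-1 * \sum_i \sum_j D3 f z (b i) (b j) (b k) * M i j C.
  pose t := 2^-1 * \sum_i \sum_j D3 f z (b i) (b j) (b k) * (2 / n.+2%:R * Hinv i j).
  have s1 : d - S C - T C @[C --> 0^'-] --> (0 : R) by exact: s0.
  have h1 : d - T C @[C --> 0^'-] --> (d - t : R).
    by apply: cvgB; [exact: cvg_cst|apply: cvgM hT; exact: cvg_cst].
  have h : d - T C - (d - S C - T C) @[C --> 0^'-] --> (d - t - 0 : R) by exact: (cvgB h1 s1).
  have <- : d - t - 0 = moment_load k.
    rewrite /moment_load subr0 /t; congr (_ - _); rewrite !mulr_sumr; apply: eq_bigr => i _.
    rewrite !mulr_sumr; apply: eq_bigr => j _.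
    have : n.+2%:R != 0 :> R by rewrite pnatr_eq0.
    move: (D3 _ _ _ _ _) (Hinv i j) (n.+2%:R : R) => x a N N0.
    by field.
  rewrite (_ : (fun C => \sum_i first_moment f z b i C * H i k) =
    (fun C => d - T C - (d - S C - T C)))//.
  apply/funext => C; have -> : d - T C - (d - S C - T C) = S C by ring.
  by apply: eq_bigr => i _; rewrite mulrC.
rewrite (_ : first_moment f z b l =
    fun C => \sum_k (\sum_i first_moment f z b i C * H i k) * Hinv k l); last first.
  apply/funext => C; exact: (mulmx_invl (fun i => first_moment f z b i C)).
by apply: cvg_sum_fin => k; apply: cvgM (hH k) _; exact: cvg_cst.
Qed.

End limits.

(** * Change of tangent frame *)

(** The matrix [A] with rows [w] and [b_i] has the right inverse [B], by the orthogonality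
    relations; [x = x B A] is then the expansion of [x], and its component along [w] vanishes. *)
Lemma tangent_frame_expand (R : realType) n (w : 'rV[R]_n.+1) (b : 'I_n -> 'rV[R]_n.+1)
    (x : 'rV[R]_n.+1) : w != 0 -> tangent_frame w b -> dot w x = 0 ->
  x = \sum_j dot x (b j) *: b j.
Proof.
move=> w0 [ob wb] wx.
have ew : dot w w != 0 by rewrite dot_eq0.
pose A : 'M[R]_(1 + n, n.+1) := col_mx w (\matrix_(i, j) b i 0 j).
pose B : 'M[R]_(n.+1, 1 + n) := row_mx ((dot w w)^-1 *: w^T) (\matrix_(i, j) b j 0 i).
have dotE (u v : 'rV[R]_n.+1) : u *m v^T = (dot u v)%:M.
  by apply/matrixP => i j; rewrite !ord1 !mxE eqxx; apply: eq_bigr => k _; rewrite mxE.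
have AB : A *m B = 1%:M.
  rewrite mul_col_row [RHS]scalar_mx_block; congr block_mx.
  - by rewrite -scalemxAr dotE scale_scalar_mx mulVf.
  - apply/rowP => j; rewrite !mxE -[RHS](wb j); apply: eq_bigr => k _; by rewrite mxE.
  - apply/colP => i; transitivity ((dot w w)^-1 * dot w (b i)); last first.
      by rewrite wb mulr0 !mxE.
    rewrite !mxE /dot mulr_sumr; apply: eq_bigr => k _.
    by rewrite !mxE mulrCA; congr (_ * _); rewrite mulrC.
  - apply/matrixP => i j; rewrite !mxE -[RHS]ob; apply: eq_bigr => k _; by rewrite !mxE.
(* The dimension count enters here: with exactly [n] vectors [b_i] the matrices are square, so a
   one-sided inverse is two-sided. *)
have BA : B *m A = 1%:M by exact: mulmx1C AB.
have E : x *m (B *m A) = x by rewrite BA mulmx1.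
rewrite mul_row_col mulmxDr !mulmxA -scalemxAr dotE dotC wx in E.
rewrite -[LHS]E -scalemxAl mul_scalar_mx scale0r scaler0 add0r mulmx_sum_row.
by apply: eq_bigr => j _; rewrite rowK mxE; congr (_ *: _); apply: eq_bigr => k _; rewrite !mxE.
Qed.

Lemma D3_combinationr (R : realType) m k (f : 'rV[R]_m -> R) (z u v : 'rV[R]_m) (I : finType)
    (a : I -> R) (w : I -> 'rV[R]_m) : Cn k.+3 f ->
  D3 f z u v (\sum_i a i *: w i) = \sum_i a i * D3 f z u v (w i).
Proof.
move=> hf; rewrite /D3.
have E : (fun y => D2 f y v (\sum_i a i *: w i)) = (fun y => \sum_i a i * D2 f y v (w i)).
  apply/funext => y; exact: (D2_combinationr _ _ _ (Cn_twice hf y)).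
apply: etrans (congr1 (fun g => 'D_u g z) E) _.
have dg i : differentiable (fun y => D2 f y v (w i)) z.
  by have [_] := Cn_twice (Cn_derive (w i) hf) z; apply.
by have [] := @derive_sum_fun R m z u I a (fun i y => D2 f y v (w i)) dg.
Qed.

Lemma pairing_combination (R : realType) n (A : 'M[R]_n) (a : 'I_n -> R)
    (d : 'I_n -> 'I_n -> 'I_n -> R) :
  \sum_p \sum_q A p q * (\sum_k a k * d p q k) =
  \sum_k a k * \sum_p \sum_q A p q * d p q k.
Proof.
under eq_bigr => p _ do under eq_bigr => q _ do rewrite mulr_sumr.
under eq_bigr do rewrite exchange_big.
rewrite exchange_big; apply: eq_bigr => k _; rewrite mulr_sumr; apply: eq_bigr => p _.
by rewrite mulr_sumr; apply: eq_bigr => q _; rewrite mulrCA.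
Qed.

Section orthogonal_congruence.
Context (R : realType) (n : nat) (P : 'M[R]_n).
Hypothesis PPt : P *m P^T = 1%:M.

Let PtP : P^T *m P = 1%:M. Proof. exact: mulmx1C PPt. Qed.

Lemma invmx_orthogonal_congr (A : 'M[R]_n) : A \in unitmx ->
  invmx (P *m A *m P^T) = P *m invmx A *m P^T.
Proof.
move=> uA.
have E : P *m A *m P^T *m (P *m invmx A *m P^T) = 1%:M.
  rewrite !mulmxA -[X in X *m invmx A]mulmxA PtP mulmx1.
  by rewrite -[X in X *m P^T]mulmxA (mulmxV uA) mulmx1.
have [ue _] := mulmx1_unit E.
by rewrite -[RHS](mulKmx ue) E mulmx1.
Qed.

Lemma mxtrace_orthogonal_congr (A B : 'M[R]_n) :
  \tr ((P *m A *m P^T)^T *m (P *m B *m P^T)) = \tr (A^T *m B).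
Proof.
rewrite !trmx_mul trmxK !mulmxA mxtrace_mulC !mulmxA PtP mul1mx.
by rewrite -[X in \tr (X *m B) = _]mulmxA PtP mulmx1.
Qed.

Lemma row_orthogonal_congr m (r : 'M[R]_(m, n)) (A : 'M[R]_n) :
  r *m P^T *m (P *m A *m P^T)^T *m P = r *m A^T.
Proof.
rewrite !trmx_mul trmxK !mulmxA -[X in X *m A^T *m _]mulmxA PtP mulmx1.
by rewrite -mulmxA PtP mulmx1.
Qed.

Lemma mxtrace_pairing (A B : 'M[R]_n) : \sum_p \sum_q A p q * B p q = \tr (A^T *m B).
Proof.
rewrite exchange_big; apply: eq_bigr => q _; rewrite mxE.
by apply: eq_bigr => p _; rewrite mxE.
Qed.

End orthogonal_congruence.

Section frame_change.
Context (R : realType) (n : nat) (w : 'rV[R]_n.+1).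
Context (b e : 'I_n -> 'rV[R]_n.+1).
Hypothesis w0 : w != 0.
Hypothesis hb : tangent_frame w b.
Hypothesis he : tangent_frame w e.

Local Notation P := (\matrix_(i, j) dot (e i) (b j) : 'M[R]_n).

Lemma frame_change_row i : e i = \sum_j P i j *: b j.
Proof.
rewrite {1}(tangent_frame_expand w0 hb (proj2 he i)).
by apply: eq_bigr => j _; rewrite mxE.
Qed.

Lemma frame_change_orthogonal : P *m P^T = 1%:M.
Proof.
apply/matrixP => i j; rewrite !mxE -(proj1 he i j) [in RHS](frame_change_row j) dot_combination.
by apply: eq_bigr => k _; rewrite !mxE mulrC.
Qed.

(* Also applied to ['D_v f], whose tangent Hessian consists of the [D3 f _ _ v]. *)
Lemma tangent_hessian_change (phi : 'rV[R]_n.+1 -> R) (z : 'rV[R]_n.+1) :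
  twice_differentiable phi z ->
  tangent_hessian phi z e = P *m tangent_hessian phi z b *m P^T.
Proof.
move=> d2; apply/matrixP => i j; rewrite mxE.
rewrite [in LHS](frame_change_row i) [in LHS](frame_change_row j).
rewrite (D2_combinationr _ _ _ d2) [RHS]mxE; apply: eq_bigr => l _.
rewrite (D2_combinationl _ _ _ d2) mulrC [in RHS]mxE; congr (_ * _); last by rewrite [RHS]mxE.
by apply: eq_bigr => k _; congr (_ * _); rewrite mxE.
Qed.

Lemma invmx_hessian_change (phi : 'rV[R]_n.+1 -> R) (z : 'rV[R]_n.+1) :
  twice_differentiable phi z -> tangent_hessian phi z b \in unitmx ->
  invmx (tangent_hessian phi z e) = P *m invmx (tangent_hessian phi z b) *m P^T.
Proof.
move=> d2 ub; rewrite (tangent_hessian_change d2).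
exact: (invmx_orthogonal_congr frame_change_orthogonal ub).
Qed.

Lemma frame_change_combination (A : 'M[R]_n) (re rb : 'rV[R]_n) : re = rb *m P^T ->
  \sum_i (re *m (P *m A *m P^T)^T) 0 i *: e i = \sum_i (rb *m A^T) 0 i *: b i.
Proof.
move=> ->; rewrite -(row_orthogonal_congr frame_change_orthogonal rb A).
move: (_ *m P^T *m _) => s.
under eq_bigr do rewrite frame_change_row scaler_sumr.
rewrite exchange_big; apply: eq_bigr => l _ /=.
rewrite [in RHS]mxE scaler_suml; apply: eq_bigr => i _.
by rewrite scalerA.
Qed.

(** The two frames differ by an orthogonal matrix [P]. The inverse Hessian is conjugated by [P], the
    coefficients paired with it are the values of one frame-independent linear form, and the factors
    [P] cancel in the resulting vector. *)
Lemma affine_normal_change (f : 'rV[R]_n.+1 -> R) (z : 'rV[R]_n.+1) :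
  Cn 4 f -> tangent_hessian f z b \in unitmx ->
  affine_normal f z e = affine_normal f z b.
Proof.
move=> hf ub.
have d2 : twice_differentiable f z by exact: (Cn_twice hf).
have d2D v : twice_differentiable (fun y => 'D_v f y) z by exact: (Cn_twice (Cn_derive v hf)).
(* The frame [g] and the free vector [v] are kept apart: for fixed [v] the contraction is the same
   in both frames, and it is linear in [v]. *)
pose t (g : 'I_n -> 'rV[R]_n.+1) v :=
  \sum_p \sum_q invmx (tangent_hessian f z g) p q * D3 f z (g p) (g q) v.
pose c g v := - (n.+2%:R^-1) * enorm (grad f z) * t g v + D2 f z (unit_normal f z) v.
pose S g := \sum_i (\sum_j invmx (tangent_hessian f z g) i j * c g (g j)) *: g i.
suff SE : S e = S b.
  by rewrite /affine_normal; exact: (congr1 (fun x => x - unit_normal f z) SE).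
have te v : t e v = t b v.
  (* In trace form, independence of the frame is the invariance of the trace under orthogonal
     conjugation. *)
  have tE g : t g v =
      \tr ((invmx (tangent_hessian f z g))^T *m tangent_hessian (fun y => 'D_v f y) z g).
    rewrite -mxtrace_pairing; apply: eq_bigr => p _; apply: eq_bigr => q _.
    by apply: (congr1 ( *%R _)); rewrite mxE.
  apply: etrans (tE e) _; apply: etrans _ (esym (tE b)).
  apply: etrans (congr2 (fun A B => \tr (A^T *m B)) (invmx_hessian_change d2 ub)
    (tangent_hessian_change (d2D v))) _.
  exact: (mxtrace_orthogonal_congr frame_change_orthogonal).
have ce v : c e v = c b v by rewrite /c te.
have cP j : c b (e j) = \sum_k P j k * c b (b k).
  apply: etrans (congr1 (c b) (frame_change_row j)) _; rewrite /c.
  have -> : t b (\sum_k P j k *: b k) = \sum_k P j k * t b (b k).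
    apply: etrans _ (pairing_combination _ (P j) (fun p q k => D3 f z (b p) (b q) (b k))).
    apply: eq_bigr => p _; apply: eq_bigr => q _.
    exact: (congr1 ( *%R _) (D3_combinationr _ _ _ _ _ hf)).
  rewrite (D2_combinationr _ _ _ d2) mulr_sumr -big_split; apply: eq_bigr => k _.
  by rewrite /= mulrDr [in RHS]mulrCA.
have {}SE g : S g = \sum_i (\row_j c g (g j) *m (invmx (tangent_hessian f z g))^T) 0 i *: g i.
  apply: eq_bigr => i _; congr (_ *: _); rewrite mxE; apply: eq_bigr => j _.
  by rewrite !mxE mulrC.
apply: etrans (SE e) _; apply: etrans _ (esym (SE b)).
apply: etrans (congr1 (fun A => \sum_i (\row_j c e (e j) *m A^T) 0 i *: e i)
  (invmx_hessian_change d2 ub)) _.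
apply: frame_change_combination; apply/rowP => j; rewrite mxE ce cP mxE.
apply: eq_bigr => k _; rewrite mulrC; congr (_ * _); first by rewrite mxE.
by rewrite [RHS]mxE.
Qed.

End frame_change.

(** * The limit direction *)

Section slice_quotient.
Context (R : realType) (n : nat) (f : 'rV[R]_n.+1 -> R) (z : 'rV[R]_n.+1).
Context (b : 'I_n -> 'rV[R]_n.+1).
Hypothesis hf : Cn 4 f.
Hypothesis hgrad : grad f z != 0.
Hypothesis hb : tangent_frame (grad f z) b.

Local Notation F := (slice_fun f z b).

(** Each coordinate of a point of the slice is an affine function of [v], and averages commute with
    affine functions. *)
Lemma slice_centroidE C : mean_on (F C) (sublevel_mean (F C)) ->
  slice_centroid f z b C =
  z + slice_vec (normal_step f z) b C (\row_i sublevel_mean (F C) (fun v => v 0 i)).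
Proof.
move=> mE; apply/rowP => k; rewrite mxE.
set U := _ @^-1` _.
have UE : U = tsublevel (F C).
  apply/seteqP; split => u; rewrite /U /tsublevel /= flat_param_point.
    by move/(slice_point hf hgrad hb).
  by move=> ?; apply/(slice_point hf hgrad hb).
rewrite UE.
pose g (v : 'rV[R]_n) := (z + C *: normal_step f z) 0 k + \sum_i v 0 i * b i 0 k.
have -> : (fun u => flat_param (z + (C / enorm (grad f z) ^+ 2) *: grad f z) b u 0 k) =
    g \o @row_of_tuple R n.
  apply/funext => u; rewrite flat_param_point /g /= /slice_vec addrA !mxE summxE; congr (_ + _).
  by apply: eq_bigr => i _; rewrite !mxE.
rewrite -/(sublevel_mean (F C) g) /g.
rewrite (meanD mE (@continuous_cst_fun R n _) (@continuous_linear_row R n _)).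
rewrite (mean_cst mE) (mean_linear mE) /slice_vec addrA [in RHS]mxE; congr (_ + _).
by rewrite summxE; apply: eq_bigr => i _; rewrite !mxE mulrC.
Qed.

Lemma slice_quotientE C : C < 0 -> mean_on (F C) (sublevel_mean (F C)) ->
  slice_quotient f z b C = - normal_step f z + \sum_i first_moment f z b i C *: b i.
Proof.
move=> C0 mE; rewrite /slice_quotient slice_centroidE// addrC addKr /slice_vec scalerDr.
rewrite scalerA invrN mulNr mulVf ?lt_eqF// scaleN1r; congr (_ + _).
rewrite scaler_sumr; apply: eq_bigr => i _.
by rewrite scalerA mxE /first_moment invrN mulrC.
Qed.

End slice_quotient.

(** The ratio comes from [normal_step] being the unit normal divided by [|grad f z|]. Symmetry of
    the inverse Hessian reconciles the contractions: the moments sum over its first index,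
    [affine_normal] over its second. *)
Lemma affine_normal_moment (R : realType) n (f : 'rV[R]_n.+1 -> R) (z : 'rV[R]_n.+1)
    (b : 'I_n -> 'rV[R]_n.+1) : Cn 4 f -> grad f z != 0 ->
  (forall i j, invmx (tangent_hessian f z b) i j = invmx (tangent_hessian f z b) j i) ->
  - normal_step f z
    + \sum_l (\sum_k moment_load f z b k * invmx (tangent_hessian f z b) k l) *: b l =
  (enorm (grad f z))^-1 *: affine_normal f z b.
Proof.
move=> hf hgrad Hsym.
have g0 : enorm (grad f z) != 0 by rewrite gt_eqF// enorm_gt0.
have n0E : normal_step f z = (enorm (grad f z))^-1 *: unit_normal f z.
  by rewrite /normal_step /unit_normal scalerA -invfM expr2.
rewrite /affine_normal scalerBr n0E addrC; congr (_ - _).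
rewrite scaler_sumr; apply: eq_bigr => i _; rewrite scalerA; congr (_ *: _).
rewrite mulr_sumr; apply: eq_bigr => k _.
rewrite Hsym /moment_load n0E (D2Zl _ _ _ (Cn_twice hf z)).
move: (\sum_i _) (invmx _ _ _) (D2 _ _ _ _) => s a d.
have N0 : n.+2%:R != 0 :> R by rewrite pnatr_eq0.
by move: (n.+2%:R : R) N0 => N N0; field; rewrite N0.
Qed.

Unset Implicit Arguments.

Theorem theorem2p2 (R : realType) (n : nat) (hn : (1 <= n)%N)
    (f : 'rV[R]_n.+1 -> R) (hf : Cn 4 f)
    (z : 'rV[R]_n.+1) (hgrad : grad f z != 0)
    (hconv : forall v : 'rV[R]_n.+1,
       v != 0 -> dot (grad f z) v = 0 -> 0 < D2 f z v v)
    (hbody : \forall C \near 0^'-,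
       convex_body (hyperplane f z C) (slice f z C))
    (b : 'I_n -> 'rV[R]_n.+1) (hb : tangent_frame (grad f z) b) :
  exists2 d_SC : 'rV[R]_n.+1,
    slice_quotient f z b C @[C --> 0^'-] --> d_SC &
    forall e : 'I_n -> 'rV[R]_n.+1, tangent_frame (grad f z) e ->
      parallel d_SC (affine_normal f z e).
Proof.
have Hsym := invmx_hessian_sym hn hf hgrad hb hconv hbody.
have dE := affine_normal_moment hf hgrad Hsym.
(* This is the exact limit, so the factor of proportionality is [1 / |grad f z|] in every frame. *)
exists ((enorm (grad f z))^-1 *: affine_normal f z b).
  rewrite -dE.
  have [K K0 hK] := slice_fun_confined hn hf hgrad hb hconv hbody.
  have hM := slice_mean_on hf hgrad hb hbody hK.
  have lim : - normal_step f z + \sum_i first_moment f z b i C *: b i @[C --> 0^'-] -->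
      - normal_step f z + \sum_l (\sum_k moment_load f z b k *
        invmx (tangent_hessian f z b) k l) *: b l.
    apply: cvgD; first exact: cvg_cst.
    apply: cvg_sum_fin => i; apply: cvgZr_tmp.
    exact: first_moment_lim.
  (* The formula for the quotient holds once the slice has an average in the sense of [mean_on],
     that is, for [C < 0] close to 0. *)
  apply: cvg_trans lim; apply: near_eq_cvg.
  apply: filterS2 hM (near_left_small (@ltr01 R)) => C mE /andP[C0 _].
  by rewrite slice_quotientE// -oppr_gt0.
move=> e he.
have -> : affine_normal f z e = affine_normal f z b.
  apply: (affine_normal_change hgrad hb he hf).
  exact: tangent_hessian_unit.
have g0 : (enorm (grad f z))^-1 != 0 by rewrite invr_eq0 gt_eqF// enorm_gt0.
(* The tangential sum is orthogonal to [grad f z], so nothing cancels the contribution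
   [- |grad f z|] of the normal part to the scalar product with [grad f z]. *)
have AN0 : affine_normal f z b != 0.
  apply/eqP => AN0.
  have : dot (grad f z) (affine_normal f z b) = - enorm (grad f z).
    rewrite /affine_normal dotDr dot_combination big1 ?add0r => [|i _]; last first.
      by rewrite (proj2 hb) mulr0.
    rewrite -scaleN1r /unit_normal !dotZr -enorm_sqr mulN1r expr2 mulKf//.
    by rewrite -invr_eq0.
  rewrite AN0 -(scale0r 0) dotZr mul0r => /eqP.
  by rewrite eq_sym oppr_eq0 gt_eqF// enorm_gt0.
split=> //; first by rewrite scaler_eq0 negb_or g0.
by exists (enorm (grad f z))^-1.
Qed.
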